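(* Let $W(3,2,2)$ be a three-web of codimension two on a four-dimensional manifold $M^4$ with nowhere vanishing covector $a$ and with integrable transversal $a$-distribution $\Delta$. The two-dimensional three-webs $W(3,2,1)$ cut on the integral surfaces of $\Delta$ by the foliations of $W(3,2,2)$ are hexagonal if and only if, in the specialized frame bundle defined by the condition $a_2=0$, the component $b^2_{222}$ of the curvature tensor of the web $W(3,2,2)$ vanishes.
   Context: A web $W(3,2,2)$ on a 4-manifold $M^4$ consists of three foliations $\lambda_1,\lambda_2,\lambda_3$ of codimension 2 in general position (their tangent planes are pairwise transversal at each point). All considerations are local. Indices $i,j,k,l$ range over $\{1,2\}$; repeated indices are summed; square brackets around indices denote alternation with averaging. The foliation $\lambda_u$ is given by $\omega_{(u)}^i=0$, $i=1,2$, where the 1-forms are normalized so that $\omega_{(1)}^i+\omega_{(2)}^i+\omega_{(3)}^i=0$; the forms $\omega_{(1)}^i,\omega_{(2)}^i$ form a coframe on $M^4$. Admissible coframe changes are $\omega_{(\alpha)}^{i'}=A^{i'}_j\omega_{(\alpha)}^j$ with the same nondegenerate matrix for $\alpha=1,2$. The structure equations are $$d\omega_{(1)}^i=\omega_{(1)}^j\wedge\omega_j^i+a_j\omega_{(1)}^j\wedge\omega_{(1)}^i,\qquad d\omega_{(2)}^i=\omega_{(2)}^j\wedge\omega_j^i-a_j\omega_{(2)}^j\wedge\omega_{(2)}^i,$$ which determine the connection forms $\omega_j^i$ and the covector $a=\{a_1,a_2\}$ (the torsion tensor being $a^i_{jk}=a_{[j}\delta^i_{k]}$), together with $$d\omega_j^i-\omega_j^k\wedge\omega_k^i=b^i_{jkl}\,\omega_{(1)}^k\wedge\omega_{(2)}^l,\qquad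 da_i-a_j\omega_i^j=p_{ij}\omega_{(1)}^j+q_{ij}\omega_{(2)}^j,$$ where $b^i_{jkl}$ is the curvature tensor, with $b^i_{[j|l|k]}=\delta^i_{[k}p_{j]l}$, $b^i_{[jk]l}=\delta^i_{[k}q_{j]l}$. The transversal $a$-distribution $\Delta$ is defined by $a_1\omega_{(1)}^1+a_2\omega_{(1)}^2=0$, $a_1\omega_{(2)}^1+a_2\omega_{(2)}^2=0$. In the specialized frames with $a_2=0$ it is given by $\omega_{(1)}^1=\omega_{(2)}^1=0$. On each (two-dimensional) integral surface $V^2$ of $\Delta$ the leaves of the three foliations cut a web $W(3,2,1)$ of three one-dimensional foliations; in the specialized frame these are $\omega_{(1)}^2=0$, $\omega_{(2)}^2=0$, $\omega_{(1)}^2+\omega_{(2)}^2=0$. A two-dimensional three-web is hexagonal if it is locally diffeomorphic to the web of three families of parallel straight lines in the plane; equivalently, its (Blaschke) curvature vanishes, where the curvature $K$ of a two-dimensional three-web given by $\sigma_1=0,\ \sigma_2=0,\ \sigma_1+\sigma_2=0$ is defined by $d\sigma_1=\sigma_1\wedge\sigma$, $d\sigma_2=\sigma_2\wedge\sigma$, $d\sigma=K\sigma_1\wedge\sigma_2$. *)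

(* Defs.v *)
From HB Require Import structures.
From mathcomp Require Import all_boot all_order all_algebra.
From mathcomp Require Import all_classical all_reals all_analysis.

Set Implicit Arguments.
Unset Strict Implicit.
Unset Printing Implicit Defensive.

Import Order.TTheory GRing.Theory Num.Theory.
Import numFieldNormedType.Exports.

Local Open Scope classical_set_scope.
Local Open Scope ring_scope.

(* The theory is local, so M^4 is an open subset U of 'rV[R]_4.  The mathematical
   indices 1, 2 (resp. 1, 2, 3) are the ordinals of value 0, 1 (resp. 0, 1, 2). *)
Definition i1 : 'I_2 := @Ordinal 2 0 isT.
Definition i2 : 'I_2 := @Ordinal 2 1 isT.
Definition u1 : 'I_3 := @Ordinal 3 0 isT.
Definition u2 : 'I_3 := @Ordinal 3 1 isT.
Definition u3 : 'I_3 := @Ordinal 3 2 isT.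

Fixpoint Ck (R : realType) (X Y : normedModType R) (k : nat) (U : set X)
    (f : X -> Y) : Prop :=
  match k with
  | 0 => forall x, U x -> {for x, continuous f}
  | k'.+1 => (forall x, U x -> differentiable f x) /\
             (forall v : X, Ck k' U ('D_v f))
  end.

(* C^oo on U; only used for open U. *)
Definition smooth_on (R : realType) (X Y : normedModType R) (U : set X)
  (f : X -> Y) : Prop := forall k, Ck k U f.

(* A 1-form is a field of covectors, given by their column of components; its
   value at x on the tangent vector v is [ev w x v]. *)
Definition form1 (R : realType) (n : nat) : Type := 'rV[R]_n -> 'cV[R]_n.

Definition form2 (R : realType) (n : nat) : Type :=
  'rV[R]_n -> 'rV[R]_n -> 'rV[R]_n -> R.

Definition ev (R : realType) (n : nat) (w : form1 R n) (x v : 'rV[R]_n) : R :=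
  (v *m w x) 0 0.

Definition wedge (R : realType) (n : nat) (w z : form1 R n) : form2 R n :=
  fun x v v' => ev w x v * ev z x v' - ev w x v' * ev z x v.

(* dw(v, v') = v(w(v')) - v'(w(v)) for constant fields v, v', so that
   d(f dg) = wedge (df) (dg). *)
Definition dform (R : realType) (n : nat) (w : form1 R n) : form2 R n :=
  fun x v v' => 'D_v (fun y => ev w y v') x - 'D_v' (fun y => ev w y v) x.

Definition pull1 (R : realType) (m n : nat) (phi : 'rV[R]_m -> 'rV[R]_n)
    (w : form1 R n) (t v : 'rV[R]_m) : R :=
  ev w (phi t) ('D_v phi t).

(* phi : D -> U is a parametrized (immersed) integral surface of the
   distribution theta_i = 0, i : I. *)
Definition integral_surface (R : realType) (I : Type) (U : set 'rV[R]_4)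
    (theta : I -> form1 R 4) (D : set 'rV[R]_2)
    (phi : 'rV[R]_2 -> 'rV[R]_4) : Prop :=
  [/\ open D, smooth_on D phi,
      (forall t, D t -> U (phi t)),
      (forall t, D t -> forall v, 'D_v phi t = 0 -> v = 0) &
      (forall t, D t -> forall i v, pull1 phi (theta i) t v = 0)].

Definition integrable2 (R : realType) (I : Type) (U : set 'rV[R]_4)
    (theta : I -> form1 R 4) : Prop :=
  forall x, U x -> exists D phi,
    integral_surface U theta D phi /\ exists2 t, D t & phi t = x.

(* omega u i is the form omega_(u)^i; the foliation lambda_u is given by
   omega u i = 0, i : 'I_2. *)
Definition web_forms (R : realType) : Type := 'I_3 -> 'I_2 -> form1 R 4.

Definition transversal_at (R : realType) (omega : web_forms R) (u w : 'I_3)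
    (x : 'rV[R]_4) : Prop :=
  forall c d : 'I_2 -> R,
    \sum_i c i *: omega u i x + \sum_i d i *: omega w i x = 0 ->
    forall i, c i = 0 /\ d i = 0.

Definition is_web322 (R : realType) (U : set 'rV[R]_4) (omega : web_forms R)
    : Prop :=
  [/\ (forall u i, smooth_on U (omega u i)),
      (forall x i, U x -> omega u1 i x + omega u2 i x + omega u3 i x = 0),
      (forall x u w, U x -> u != w -> transversal_at omega u w x) &
      (forall u, integrable2 U (omega u))].

Definition admissible_change (R : realType) (V : set 'rV[R]_4)
    (omega omega' : web_forms R) : Prop :=
  exists A : 'rV[R]_4 -> 'M[R]_2,
    [/\ smooth_on V A,
        (forall x, V x -> A x \in unitmx) &
        (forall x, V x -> forall u i,
           omega' u i x = \sum_j A x i j *: omega u j x)].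

(* conn j i is omega_j^i, curv i j k l is b^i_{jkl}. *)
Record web_structure (R : realType) := WebStructure {
  conn : 'I_2 -> 'I_2 -> form1 R 4;
  cov  : 'I_2 -> 'rV[R]_4 -> R;
  pcov : 'I_2 -> 'I_2 -> 'rV[R]_4 -> R;
  qcov : 'I_2 -> 'I_2 -> 'rV[R]_4 -> R;
  curv : 'I_2 -> 'I_2 -> 'I_2 -> 'I_2 -> 'rV[R]_4 -> R
}.

Definition alt (R : realType) (f : 'I_2 -> 'I_2 -> R) (j k : 'I_2) : R :=
  (f j k - f k j) / 2.

Definition delta (R : realType) (i j : 'I_2) : R := (i == j)%:R.

Definition structure_equations (R : realType) (U : set 'rV[R]_4)
    (omega : web_forms R) (S : web_structure R) : Prop :=
  [/\ (forall j i, smooth_on U (conn S j i)) /\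
        (forall i, smooth_on U (cov S i : 'rV[R]_4 -> R^o)),
      (forall x, U x -> forall i v v',
         dform (omega u1 i) x v v' =
           \sum_j wedge (omega u1 j) (conn S j i) x v v' +
           \sum_j cov S j x * wedge (omega u1 j) (omega u1 i) x v v' /\
         dform (omega u2 i) x v v' =
           \sum_j wedge (omega u2 j) (conn S j i) x v v' -
           \sum_j cov S j x * wedge (omega u2 j) (omega u2 i) x v v'),
      (forall x, U x -> forall i j v v',
         dform (conn S j i) x v v' -
         \sum_k wedge (conn S j k) (conn S k i) x v v' =
         \sum_k \sum_l curv S i j k l x *
           wedge (omega u1 k) (omega u2 l) x v v'),
      (forall x, U x -> forall i v,
         'D_v (cov S i : 'rV[R]_4 -> R^o) x -
         \sum_j cov S j x * ev (conn S i j) x v =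
         \sum_j (pcov S i j x * ev (omega u1 j) x v +
                 qcov S i j x * ev (omega u2 j) x v)) &
      (forall x, U x -> forall i j k l,
         alt (fun j' k' => curv S i j' l k' x) j k =
           alt (fun k' j' => delta R i k' * pcov S j' l x) k j /\
         alt (fun j' k' => curv S i j' k' l x) j k =
           alt (fun k' j' => delta R i k' * qcov S j' l x) k j)].

(* The forms a_i omega_(1)^i, a_i omega_(2)^i defining the transversal
   a-distribution Delta. *)
Definition a_distribution (R : realType) (omega : web_forms R)
    (S : web_structure R) (alpha : bool) : form1 R 4 :=
  fun x => \sum_i cov S i x *: omega (if alpha then u2 else u1) i x.

(* A three-web of curves on an open subset of the plane is given by the tangent
   lines: [W u t] is the tangent line at t to the curve of the u-th family. *)
Definition plane_web (R : realType) : Type := 'I_3 -> 'rV[R]_2 -> set 'rV[R]_2.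

(* The web of the straight lines x = const, y = const, x + y = const. *)
Definition parallel_web (R : realType) : plane_web R :=
  fun u _ v =>
    if u == u1 then v 0 i1 = 0
    else if u == u2 then v 0 i2 = 0
    else v 0 i1 + v 0 i2 = 0.

Definition diffeomorphism (R : realType) (N N' : set 'rV[R]_2)
    (psi : 'rV[R]_2 -> 'rV[R]_2) : Prop :=
  [/\ open N, open N', smooth_on N psi,
      (forall s, N s -> N' (psi s)) &
      exists chi : 'rV[R]_2 -> 'rV[R]_2,
        [/\ smooth_on N' chi, (forall y, N' y -> N (chi y)),
            (forall s, N s -> chi (psi s) = s) &
            (forall y, N' y -> psi (chi y) = y)]].

Definition hexagonal (R : realType) (D : set 'rV[R]_2) (W : plane_web R) : Prop :=
  forall t, D t -> exists N N' psi,
    [/\ N t, N `<=` D, diffeomorphism N N' psi &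
        forall s, N s -> forall u v,
          W u s v <-> parallel_web u (psi s) ('D_v psi s)].

(* The web W(3,2,1) cut by the three foliations on the surface phi. *)
Definition cut_web (R : realType) (omega : web_forms R)
    (phi : 'rV[R]_2 -> 'rV[R]_4) : plane_web R :=
  fun u t v => forall i, pull1 phi (omega u i) t v = 0.

(* Main.v *)
(* In a frame with a_2 = 0, the structure equations pulled back to an integral surface
   of Delta, where omega_(1)^1 = omega_(2)^1 = 0, first force omega_2^1 = 0 and then become
     d s1 = s1 /\ s,  d s2 = s2 /\ s,  d s = b^2_222 s1 /\ s2
   for s1 = omega_(1)^2, s2 = omega_(2)^2, s = omega_2^2: so b^2_222 is the Blaschke
   curvature of the cut web.
   If a diffeomorphism (X, Y) straightens this web, then dX = F s1 and dY = F s2 with a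
   common factor F; differentiating gives dF = F s, hence d s = 0.  Conversely, if d s = 0
   then s = dg locally, the forms e^g s1 and e^g s2 are closed, and their primitives
   are the components of a straightening local diffeomorphism.
   The frame with first covector row (a_1, a_2) and second row (-a_2, a_1) is
   specialized everywhere; conversely the covector of any other structure on a changed
   frame is determined by uniqueness of the connection. *)
Require Import Defs.
From HB Require Import structures.
From mathcomp Require Import all_boot all_order all_algebra.
From mathcomp Require Import all_classical all_reals all_analysis.
From mathcomp Require Import ring lra.
Set Implicit Arguments.
Unset Strict Implicit.
Unset Printing Implicit Defensive.
Import Order.TTheory GRing.Theory Num.Theory.
Import numFieldNormedType.Exports.
Local Open Scope classical_set_scope.
Local Open Scope ring_scope.

(** * Functions of class C^k *)

(** The two directions need different tools. From hexagonality, an arbitrary specialized frame is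
    given, and what matters is a = a'A: it makes a'_2 = 0 say that Delta is given by the vanishing
    of the first forms of that frame. From b^2_222 = 0, one specialized frame suffices, but all of
    its structure equations must be produced, curvature and alternation identities included; this is
    the purpose of the explicit transformation laws. The form omega_2^1 vanishes because the
    equations of both foliations restrict to omega_(u)^2 /\ omega_2^1 = 0, so that it is
    proportional to two independent forms. The equality dF = F s has the same origin: (dF - F s) /\
    s1 and (dF - F s) /\ s2 are both zero. The third foliation is what makes the factors of s1 and
    s2 equal. Smoothness is expressed by iterated derivatives in fixed directions. The symmetry of
    second derivatives, the Poincare lemma and the inverse function theorem are established for this
    notion, mostly coordinate by coordinate. *)

Section CkCalculus.
Context {R : realType}.
Implicit Types (X Y : normedModType R).

(** ['d f x] is picked by a choice operator; uniqueness of first-order expansions identifies it with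
    [L], and the expansion itself is then the definition of differentiability. *)
Lemma differentiableP_eps X Y (f : X -> Y) x (L : {linear X -> Y}) :
  continuous L ->
  (forall e : R, 0 < e ->
     \forall w \near (0 : X), `|f (w + x) - f x - L w| <= e * `|w|) ->
  differentiable f x /\ ('d f x = L :> (X -> Y)).
Proof.
move=> Lc H.
have E : f \o shift x = cst (f x) + L +o_ (0 : X) id.
  apply/eqaddoP => e e0; near=> w => /=.
  have -> : (f \o shift x - (cst (f x) + L)) w = f (w + x) - f x - L w.
    by rewrite !fctE opprD addrA.
  near: w; exact: H.
have dE := diff_unique Lc E.
by split => //; apply/diff_locallyP; rewrite dE.
Unshelve. all: by end_near. Qed.

Lemma near_eq_differentiable X Y (f g : X -> Y) x :
  {near x, f =1 g} -> differentiable f x -> differentiable g x.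
Proof.
move=> fg df.
have [] := @differentiableP_eps X Y g x ('d f x) (diff_continuous df) _; last by [].
move=> e e0.
have /eqaddoP/(_ e e0) H : f \o shift x = cst (f x) + 'd f x +o_ (0 : X) id.
  by have /diff_locallyP[] := df.
have fg0 : \forall w \near (0 : X), f (w + x) = g (w + x).
  by move: fg; rewrite (near_shift 0 x) /= subr0.
near=> w.
rewrite -(nbhs_singleton fg).
have <- : f (w + x) = g (w + x) by near: w.
have -> : f (w + x) - f x - 'd f x w = (f \o shift x - (cst (f x) + 'd f x)) w.
  by rewrite !fctE opprD addrA.
near: w; exact: H.
Unshelve. all: by end_near. Qed.

Lemma Ck_diff X Y k (U : set X) (f : X -> Y) x : Ck k.+1 U f -> U x ->
  differentiable f x.
Proof. by move=> [df _] /df. Qed.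

Lemma Ck_continuous X Y (U : set X) (f : X -> Y) x : Ck 0 U f -> U x ->
  {for x, continuous f}.
Proof. by apply. Qed.

Lemma Ck_D X Y k (U : set X) (f : X -> Y) v : Ck k.+1 U f -> Ck k U ('D_v f).
Proof. by move=> [_]; apply. Qed.

Lemma Ck_sub X Y k (U V : set X) (f : X -> Y) : V `<=` U -> Ck k U f -> Ck k V f.
Proof.
move=> VU; elim: k f => [|k IH] f /=; first by move=> H x /VU /H.
by move=> [df H]; split => [x /VU/df //|v]; exact: IH.
Qed.

(** A derivative at a point depends only on the germ there, and openness of [U] turns equality on
    [U] into equality of germs. Most closure properties below replace ['D_v] of a compound function
    by its formula through this lemma. *)
Lemma Ck_eq X Y k (U : set X) (f g : X -> Y) :
  open U -> (forall x, U x -> f x = g x) -> Ck k U f -> Ck k U g.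
Proof.
move=> oU; elim: k f g => [|k IH] f g fg /=.
  move=> fc x Ux; apply: (@cvg_trans _ (f @ x)).
    apply: near_eq_cvg; near=> y; apply: fg; near: y.
    by move: oU; rewrite openE; apply.
  rewrite -fg//; exact: fc.
have nfg x : U x -> {near x, f =1 g}.
  by move=> Ux; near=> y; apply: fg; near: y; move: oU; rewrite openE; apply.
move=> [df Hf]; split=> [x Ux|v].
  exact: (near_eq_differentiable (nfg _ Ux) (df _ Ux)).
by apply: IH (Hf v) => x Ux; apply: near_eq_derive; exact: nfg.
Unshelve. all: by end_near. Qed.

Lemma CkW X Y k (U : set X) (f : X -> Y) : Ck k.+1 U f -> Ck k U f.
Proof.
elim: k f => [|k IH] f [df Hf].
  by move=> x Ux; apply: differentiable_continuous; exact: df.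
by split=> // v; apply: IH.
Qed.

Lemma Ck_cst X Y k (U : set X) (c : Y) : Ck k U (fun=> c).
Proof.
elim: k c => [|k IH] c /=; first by move=> x _; exact: cvg_cst.
split=> [x _|v]; first exact: differentiable_cst.
have -> : 'D_v (fun _ : X => c) = fun=> 0 by apply/funext => x; exact: derive_cst.
exact: IH.
Qed.

Lemma Ck_id X k (U : set X) : Ck k U id.
Proof.
case: k => [|k] /=; first by move=> x _; exact: cvg_id.
split=> [x _|v]; first exact: ex_diff.
have -> : 'D_v (id : X -> X) = fun=> v by apply/funext => x; exact: derive_id.
exact: Ck_cst.
Qed.

Lemma Ck_add X Y k (U : set X) (f g : X -> Y) : open U ->
  Ck k U f -> Ck k U g -> Ck k U (fun x => f x + g x).
Proof.
move=> oU; elim: k f g => [|k IH] f g /=.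
  by move=> fc gc x Ux; apply: cvgD; [exact: fc|exact: gc].
move=> [df Hf] [dg Hg]; split=> [x Ux|v].
  by apply: differentiableD; [exact: df|exact: dg].
apply: (@Ck_eq _ _ _ _ (fun x => 'D_v f x + 'D_v g x)) => // [x Ux|]; last exact: IH.
by rewrite -deriveD//; apply: diff_derivable; [exact: df|exact: dg].
Qed.

Lemma Ck_mul X k (U : set X) (f g : X -> R) : open U ->
  Ck k U f -> Ck k U g -> Ck k U (fun x => f x * g x : R).
Proof.
move=> oU; elim: k f g => [|k IH] f g Cf Cg.
  by move=> x Ux; apply: cvgM; [exact: Cf|exact: Cg].
split=> [x Ux|v].
  by apply: differentiableM; [exact: Ck_diff Cf Ux|exact: Ck_diff Cg Ux].
apply: (@Ck_eq _ _ _ _ (fun x => f x * 'D_v g x + g x * 'D_v f x)) => // [x Ux|].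
  by rewrite [RHS]deriveM//; apply: diff_derivable; [exact: Ck_diff Cf Ux|exact: Ck_diff Cg Ux].
by apply: Ck_add => //; apply: IH; by [exact: CkW | exact: Ck_D].
Qed.

(** The formula for the derivative contains the inverse of [f] again, but only to the order already
    covered by the induction hypothesis. *)
Lemma Ck_inv X k (U : set X) (f : X -> R) : open U -> (forall x, U x -> f x != 0) ->
  Ck k U f -> Ck k U (fun x => (f x)^-1 : R).
Proof.
move=> oU f0; elim: k => [|k IH] Cf.
  by move=> x Ux; apply: (cvgV (f0 _ Ux)); exact: Cf.
split=> [x Ux|v].
  by apply: differentiableV; [exact: Ck_diff Cf Ux|exact: f0].
apply: (@Ck_eq _ _ _ _ (fun x => - 1 * ((f x)^-1 * (f x)^-1) * 'D_v f x)) => // [x Ux|].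
  rewrite [RHS]deriveV//; [|exact: f0|exact/diff_derivable/(Ck_diff Cf)].
  by rewrite /GRing.scale/= -exprVn expr2 mulN1r.
have Cfi := IH (CkW Cf).
apply: Ck_mul => //; last exact: Ck_D.
by apply: Ck_mul => //; [exact: Ck_cst|exact: Ck_mul].
Qed.

Lemma differentiable_mxP X m n (M : X -> 'M[R]_(m, n)) x :
  differentiable M x <-> forall i j, differentiable (fun x => M x i j : R) x.
Proof.
split=> [dM i j|dM].
  exact: (@differentiable_comp _ _ _ _ M (fun N => N i j)) dM (differentiable_coord _ _ _).
rewrite (_ : M = \sum_i \sum_j (fun y => M y i j *: delta_mx i j)).
  apply: differentiable_sum => i; apply: differentiable_sum => j.
  exact: differentiableZl.
apply/funext => y; rewrite {1}(matrix_sum_delta (M y)) fct_sumE.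
by apply: eq_bigr => i _; rewrite fct_sumE.
Qed.

Lemma derive_coord X m n (M : X -> 'M[R]_(m, n)) x v i j : differentiable M x ->
  'D_v M x i j = 'D_v (fun x => M x i j : R) x.
Proof. by move=> dM; rewrite derive_mx ?mxE//; exact: diff_derivable. Qed.

Lemma Ck_mxP X m n k (U : set X) (M : X -> 'M[R]_(m, n)) : open U ->
  Ck k U M <-> forall i j, Ck k U (fun x => M x i j : R).
Proof.
move=> oU; elim: k M => [|k IH] M.
  split=> [cM i j x Ux|cM x Ux].
    exact: (continuous_comp (cM _ Ux) (@coord_continuous _ _ _ i j _)).
  apply/cvgrPdist_le => e e0; near=> y.
  rewrite /Num.Def.normr/= mx_normrE (bigmax_le _ (ltW e0))//= => i _.
  rewrite !mxE/=; move: i; near: y; apply: filter_forall => -[i j] /=.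
  exact: ((cvgrPdist_le _ _).1 (cM i j x Ux)).
split=> [[dM HM] i j|H].
  split=> [x Ux|v]; first exact: (differentiable_mxP _ _).1 (dM _ Ux) i j.
  apply: (@Ck_eq _ _ _ _ (fun x => 'D_v M x i j)) => // [x Ux|].
    by apply: derive_coord; exact: dM.
  exact: ((IH _).1 (HM v)).
have dM x : U x -> differentiable M x.
  by move=> Ux; apply/differentiable_mxP => i j; exact: Ck_diff (H i j) Ux.
split=> // v; apply/IH => i j.
apply: (@Ck_eq _ _ _ _ ('D_v (fun x => M x i j : R))) => // [x Ux|].
  by rewrite derive_coord//; exact: dM.
exact: Ck_D.
Unshelve. all: by end_near. Qed.

Lemma Ck_sum X (I : finType) k (U : set X) (f : I -> X -> R) : open U ->
  (forall i, Ck k U (f i)) -> Ck k U (fun x => \sum_i f i x : R).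
Proof.
move=> oU H; rewrite /index_enum/=; elim: (Finite.enum I) => [|i s IH].
  apply: (@Ck_eq _ R k _ (fun=> 0 : R)) => // [x _|]; [by rewrite big_nil|exact: Ck_cst].
apply: (@Ck_eq _ _ _ _ (fun x => f i x + \sum_(j <- s) f j x)) => // [x _|].
  by rewrite big_cons.
exact: Ck_add.
Qed.

Lemma Ck_prod X (I : finType) k (U : set X) (f : I -> X -> R) : open U ->
  (forall i, Ck k U (f i)) -> Ck k U (fun x => \prod_i f i x : R).
Proof.
move=> oU H; rewrite /index_enum/=; elim: (Finite.enum I) => [|i s IH].
  apply: (@Ck_eq _ R k _ (fun=> 1 : R)) => // [x _|]; [by rewrite big_nil|exact: Ck_cst].
apply: (@Ck_eq _ _ _ _ (fun x => f i x * \prod_(j <- s) f j x)) => // [x _|].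
  by rewrite big_cons.
exact: Ck_mul.
Qed.

Lemma Ck_opp X k (U : set X) (f : X -> R) : open U ->
  Ck k U f -> Ck k U (fun x => - f x : R).
Proof.
move=> oU Cf; apply: (@Ck_eq _ _ _ _ (fun x => -1 * f x)) => // [x _|].
  by rewrite mulN1r.
by apply: Ck_mul => //; exact: Ck_cst.
Qed.

Lemma deriveDv X Y (f : X -> Y) x u v : differentiable f x ->
  'D_(u + v) f x = 'D_u f x + 'D_v f x.
Proof. by move=> df; rewrite !(deriveE _ df); exact: (linearD ('d f x)). Qed.

Lemma deriveZv X Y (f : X -> Y) x a v : differentiable f x ->
  'D_(a *: v) f x = a *: 'D_v f x.
Proof. by move=> df; rewrite !(deriveE _ df); exact: (linearZZ ('d f x)). Qed.

Lemma derive_row Y n (f : 'rV[R]_n -> Y) x v : differentiable f x ->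
  'D_v f x = \sum_i v 0 i *: 'D_(delta_mx 0 i) f x.
Proof.
move=> df; rewrite {1}(row_sum_delta v) (deriveE _ df) (linear_sum ('d f x)).
by apply: eq_bigr => i _; rewrite (deriveE _ df); exact: (linearZZ ('d f x)).
Qed.

Lemma derive_comp X X' Y (f : X -> X') (g : X' -> Y) x v :
  differentiable f x -> differentiable g (f x) ->
  'D_v (fun y => g (f y)) x = 'D_('D_v f x) g (f x).
Proof.
move=> df dg; rewrite (deriveE _ dg) (deriveE _ df).
by rewrite (deriveE _ (differentiable_comp df dg)) diff_comp.
Qed.

(** The direction ['D_v f x] moves with [x], whereas [Ck] only speaks of fixed directions. Expanding
    it in the standard basis leaves coordinates of ['D_v f] times fixed-direction derivatives of [g]
    composed with [f], to which the induction hypothesis applies. *)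
Lemma Ck_comp X n k (U : set X) (V : set 'rV[R]_n) (f : X -> 'rV[R]_n)
    (g : 'rV[R]_n -> R) : open U -> (forall x, U x -> V (f x)) ->
  Ck k U f -> Ck k V g -> Ck k U (fun x => g (f x) : R).
Proof.
move=> oU UV; elim: k g => [|k IH] g Cf Cg.
  by move=> x Ux; apply: (continuous_comp (Cf _ Ux)); exact/Cg/UV.
have dg x : U x -> differentiable g (f x) by move=> Ux; exact/(Ck_diff Cg)/UV.
split=> [x Ux|v].
  by apply: differentiable_comp; [exact: Ck_diff Cf Ux|exact: dg].
apply: (@Ck_eq _ _ _ _
  (fun x => \sum_i 'D_v f x 0 i * 'D_(delta_mx 0 i) g (f x))) => // [x Ux|].
  by rewrite (derive_comp _ (Ck_diff Cf Ux) (dg _ Ux)) (derive_row _ (dg _ Ux)).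
apply: Ck_sum => // i; apply: Ck_mul => //.
  by move: (Ck_D v Cf) => /(Ck_mxP _ _ oU).
exact: (IH _ (CkW Cf) (Ck_D _ Cg)).
Qed.

Lemma deriveEcvg X Y (f : X -> Y) a v :
  'D_v f a = lim (h^-1 *: ((f \o shift a) (h *: v) - f a) @[h --> 0^']).
Proof. by []. Qed.

(** The difference quotients along the line and in direction [v] are the same function of [h]; this
    carries the one-variable mean value theorem over to directional derivatives. *)
Lemma is_derive_line X Y (f : X -> Y) x v (s : R) : derivable f (s *: v + x) v ->
  is_derive s 1 (fun t : R => f (t *: v + x)) ('D_v f (s *: v + x)).
Proof.
have E : (fun h : R => h^-1 *: (((fun t : R => f (t *: v + x)) \o shift s) (h *: 1)
      - f (s *: v + x))) =
    (fun h => h^-1 *: ((f \o shift (s *: v + x)) (h *: v) - f (s *: v + x))).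
  by apply/funext => h /=; rewrite [h *: 1]mulr1 scalerDl addrA.
by move=> df; split; rewrite /derivable /derive E.
Qed.

Lemma is_derive_along X Y (f : X -> Y) x v d :
  is_derive (0 : R) 1 (fun t : R => f (t *: v + x)) d -> is_derive x v f d.
Proof.
have E : (fun h : R => h^-1 *: (((fun t : R => f (t *: v + x)) \o shift 0) (h *: 1)
      - f (0 *: v + x))) = (fun h => h^-1 *: ((f \o shift x) (h *: v) - f x)).
  by apply/funext => h /=; rewrite [h *: 1]mulr1 addr0 scale0r add0r.
by move=> -[df <-]; split; [move: df|]; rewrite /derivable /derive E.
Qed.

Lemma MVT_line X (f : X -> R) x v :
  (forall s : R, 0 <= s <= 1 -> derivable f (s *: v + x) v) ->
  exists2 s : R, 0 < s < 1 & f (v + x) - f x = 'D_v f (s *: v + x).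
Proof.
move=> df; pose g (t : R) := f (t *: v + x).
have dg (t : R) : t \in `[0, 1] -> is_derive t 1 g ('D_v f (t *: v + x)).
  by rewrite in_itv/= => t01; apply: is_derive_line; exact: df.
have dgo (t : R) : t \in `]0, 1[ -> is_derive t 1 g ('D_v f (t *: v + x)).
  by move=> t01; apply: dg; exact: subset_itv_oo_cc.
have gc : {within `[0, 1], continuous g}.
  by apply: derivable_within_continuous => t /dg [].
have [t t01] := MVT ltr01 dgo gc.
rewrite /g scale1r scale0r add0r subr0 mulr1 => ->.
by exists t => //; move: t01; rewrite in_itv.
Qed.

End CkCalculus.

(* Otherwise conversion unfolds derivatives down to limits of filters. *)
Local Opaque derive.

(** * Symmetry of second derivatives *)

Section Schwarz.
Context {R : realType}.
Implicit Types (X Y : normedModType R).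

(** The mean value theorem is used twice: on [g] along [h *: v], then on ['D_v f] along [h *: w].
    The second difference is symmetric in [v] and [w], which is what makes the order of the
    derivatives exchangeable. *)
Lemma second_difference X (f : X -> R) (U : set X) x v w (h : R) : 0 < h ->
  (forall y, U y -> differentiable f y) ->
  (forall y, U y -> differentiable ('D_v f) y) ->
  (forall s t : R, 0 <= s <= h -> 0 <= t <= h -> U (t *: w + (s *: v + x))) ->
  exists s t : R, [/\ 0 <= s <= h, 0 <= t <= h &
    f (h *: w + (h *: v + x)) - f (h *: v + x) - (f (h *: w + x) - f x) =
    h * h * 'D_w ('D_v f) (t *: w + (s *: v + x))].
Proof.
move=> h0 df ddf HU.
have mem s : 0 <= s <= 1 -> 0 <= s * h <= h.
  by move=> /andP[s0 s1]; rewrite mulr_ge0 ?(ltW h0)//= ler_piMl// ltW.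
have Us s : 0 <= s <= h -> U (s *: v + x).
  by move=> sh; have := HU s 0 sh; rewrite scale0r add0r lexx (ltW h0); exact.
have hh : 0 <= h <= h by rewrite lexx ltW.
pose g y := f (h *: w + y) - f y.
have dsh (u y : X) : is_diff y (fun z => u + z) id.
  by apply: is_diff_eq; rewrite add0r.
have dfw s : 0 <= s <= h -> differentiable (fun y => f (h *: w + y)) (s *: v + x).
  move=> sh; apply: (@differentiable_comp _ _ _ _ (fun y => h *: w + y) f).
    exact: ex_diff.
  exact/df/HU.
have dg s : 0 <= s <= h -> differentiable g (s *: v + x).
  by move=> sh; apply: differentiableB; [exact: dfw|exact/df/Us].
have [s /andP[s0 s1]] : exists2 s : R, 0 < s < 1 &
    g (h *: v + x) - g x = 'D_(h *: v) g (s *: (h *: v) + x).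
  by apply: MVT_line => s s01; apply: diff_derivable; rewrite scalerA; apply: dg; exact: mem.
have sh : 0 <= s * h <= h by apply: mem; rewrite !ltW.
rewrite scalerA (deriveZv _ _ (dg _ sh)).
have -> : 'D_v g (s * h *: v + x) =
    'D_v f (h *: w + (s * h *: v + x)) - 'D_v f (s * h *: v + x).
  rewrite [LHS]deriveB; [|exact/diff_derivable/dfw|exact/diff_derivable/df/Us].
  congr (_ - _).
  have dd : differentiable (fun y => h *: w + y) (s * h *: v + x) by exact: ex_diff.
  by rewrite (derive_comp _ dd) ?(deriveE _ dd) ?diff_val//; exact/df/HU.
have [t /andP[t0 t1]] : exists2 t : R, 0 < t < 1 &
    'D_v f (h *: w + (s * h *: v + x)) - 'D_v f (s * h *: v + x)
    = 'D_(h *: w) ('D_v f) (t *: (h *: w) + (s * h *: v + x)).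
  apply: (@MVT_line _ _ ('D_v f) (s * h *: v + x) (h *: w)) => t t01.
  by apply: diff_derivable; rewrite scalerA; apply: ddf; apply: HU => //; exact: mem.
have th : 0 <= t * h <= h by apply: mem; rewrite !ltW.
rewrite scalerA (deriveZv _ _ (ddf _ (HU _ _ sh th))) => -> E.
by exists (s * h), (t * h); split => //; rewrite [LHS]E /GRing.scale/= mulrA.
Qed.

Lemma ler_dist_half (e a b c : R) :
  `|a - c| <= e / 2 -> `|b - c| <= e / 2 -> `|a - b| <= e.
Proof.
move=> ac bc; rewrite (splitr e) (le_trans (ler_distD c a b))//.
by apply: lerD => //; rewrite distrC.
Qed.

Lemma derive_commute X (f : X -> R) (U : set X) x v w : open U -> U x -> Ck 2 U f ->
  'D_v ('D_w f) x = 'D_w ('D_v f) x.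
Proof.
move=> oU Ux Cf; apply/eqP; rewrite -subr_eq0 -normr_le0; apply/ler_addgt0Pr => e.
rewrite add0r; move: e.
suff : forall e : R, 0 < e -> `|'D_v ('D_w f) x - 'D_w ('D_v f) x| <= e by [].
move=> e e0.
have e2 : 0 < e / 2 by rewrite divr_gt0.
have cvw := Ck_continuous (Ck_D w (Ck_D v Cf)) Ux.
have cwv := Ck_continuous (Ck_D v (Ck_D w Cf)) Ux.
have n1 : \forall y \near x, `|'D_v ('D_w f) x - 'D_v ('D_w f) y| <= e / 2.
  by move/cvgrPdist_le : cwv; apply.
have n2 : \forall y \near x, `|'D_w ('D_v f) x - 'D_w ('D_v f) y| <= e / 2.
  by move/cvgrPdist_le : cvw; apply.
have n0 : \forall y \near x, U y by move: oU; rewrite openE; apply.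
have [r /= r0 Hr] := (nbhs_ballP _ _).1 (filterI n0 (filterI n1 n2)).
(* The parallelogram spanned by [h *: v] and [h *: w] at [x] stays in the ball of radius [r]; the
   [1] keeps the denominator positive when [v] and [w] vanish. *)
pose h := r / (2 * (`|v| + `|w| + 1)).
have N0 : 0 < `|v| + `|w| + 1 by rewrite ltr_wpDl// addr_ge0.
have h0 : 0 < h by rewrite divr_gt0// mulr_gt0.
have B s t u z : `|u| + `|z| = `|v| + `|w| -> 0 <= s <= h -> 0 <= t <= h ->
    ball x r (t *: z + (s *: u + x)).
  move=> uz /andP[s0 sh] /andP[t0 th]; rewrite -ball_normE/= distrC addrA addrK.
  rewrite (le_lt_trans (ler_normD _ _))// !normrZ !ger0_norm//.
  apply: (@le_lt_trans _ _ (h * (`|v| + `|w|))).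
    by rewrite -uz mulrDr addrC lerD// ler_wpM2r.
  rewrite /h mulrAC ltr_pdivrMr ?mulr_gt0// ltr_pM2l//.
  have := normr_ge0 v; have := normr_ge0 w; lra.
have B1 s t : 0 <= s <= h -> 0 <= t <= h -> ball x r (t *: w + (s *: v + x)).
  by move=> *; apply: B.
have B2 s t : 0 <= s <= h -> 0 <= t <= h -> ball x r (t *: v + (s *: w + x)).
  by move=> *; apply: B => //; rewrite addrC.
have df y : ball x r y -> differentiable f y by move=> /Hr[Uy _]; exact: Ck_diff Cf Uy.
have ddf u y : ball x r y -> differentiable ('D_u f) y.
  by move=> /Hr[Uy _]; exact: Ck_diff (Ck_D u Cf) Uy.
have [s [t [sh th E1]]] := second_difference h0 df (ddf v) B1.
have [s' [t' [sh' th' E2]]] := second_difference h0 df (ddf w) B2.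
(* Both orders give the same second difference, so the two mixed derivatives coincide at two points
   of the ball, possibly different; their continuity at [x] does the rest. *)
have E : 'D_w ('D_v f) (t *: w + (s *: v + x)) = 'D_v ('D_w f) (t' *: v + (s' *: w + x)).
  apply: (@mulfI _ (h * h)); first by rewrite mulf_neq0// gt_eqF.
  apply: (etrans (esym E1)); apply: etrans _ E2; rewrite (addrCA (h *: w)).
  move: (f _) (f _) (f _) (f _) => p q u z; ring.
have [_ [_ A1]] := Hr _ (B1 _ _ sh th); have [_ [A2 _]] := Hr _ (B2 _ _ sh' th').
rewrite -E in A2.
exact: ler_dist_half A2 A1.
Qed.

End Schwarz.

(** * Mean value estimates in the maximum norm *)

Section MeanValue.
Context {R : realType}.
Implicit Types (X Y : normedModType R).

Lemma mx_norm_coord m n (A : 'M[R]_(m, n)) i j : `|A i j| <= `|A|.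
Proof. by rewrite [leRHS]/Num.Def.normr/= mx_normrE; exact: (le_bigmax _ _ (i, j)). Qed.

Lemma mx_norm_le m n (A : 'M[R]_(m, n)) (c : R) : 0 <= c ->
  (forall i j, `|A i j| <= c) -> `|A| <= c.
Proof.
by move=> c0 H; rewrite [leLHS]/Num.Def.normr/= mx_normrE (bigmax_le _ c0).
Qed.

Lemma mx_norm_mul m n p (A : 'M[R]_(m, n)) (B : 'M[R]_(n, p)) :
  `|A *m B| <= n%:R * `|A| * `|B|.
Proof.
apply: mx_norm_le => [|i j]; first by rewrite !mulr_ge0.
rewrite mxE (le_trans (ler_norm_sum _ _ _))//.
rewrite (@le_trans _ _ (\sum_(k < n) `|A| * `|B|))//.
  by apply: ler_sum => k _; rewrite normrM ler_pM// mx_norm_coord.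
by rewrite sumr_const card_ord -[leLHS]mulr_natl mulrA.
Qed.

Lemma ball_segment X (c x y : X) (r s : R) : ball c r x -> ball c r y ->
  0 <= s <= 1 -> ball c r (s *: (x - y) + y).
Proof.
rewrite -ball_normE /= => cx cy /andP[s0 s1].
rewrite (_ : c - _ = s *: (c - x) + (1 - s) *: (c - y)); last first.
  rewrite scalerBl scale1r addrCA -scalerBr opprB [c - x + _]addrC addrA subrK.
  by rewrite -[y - x]opprB scalerN opprD addrA addrAC.
rewrite (le_lt_trans (ler_normD _ _))// !normrZ ger0_norm// ger0_norm ?subr_ge0//.
have [->|sn1] := eqVneq s 1; first by rewrite subrr mul0r addr0 mul1r.
apply: (@lt_le_trans _ _ (s * r + (1 - s) * r)); last by rewrite -mulrDl addrC subrK mul1r.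
apply: ler_ltD; first by rewrite ler_wpM2l// ltW.
by rewrite ltr_pM2l// subr_gt0 lt_neqAle sn1.
Qed.

(** The norm is the maximum of the coordinates, so the scalar mean value theorem, applied to each
    coordinate on a segment of the convex ball, gives the bound with the same constant [k]. *)
Lemma derive_lipschitz X n (g : X -> 'rV[R]_n) (c : X) (r k : R) :
  0 <= k -> (forall x, ball c r x -> differentiable g x) ->
  (forall x v, ball c r x -> `|'D_v g x| <= k * `|v|) ->
  forall x y, ball c r x -> ball c r y -> `|g x - g y| <= k * `|x - y|.
Proof.
move=> k0 dg Hg x y Bx By; apply: mx_norm_le => [|i j]; first by rewrite mulr_ge0.
pose h z : R := g z i j.
have dh z : ball c r z -> differentiable h z.
  by move=> /dg dgz; exact: (differentiable_mxP _ _).1 dgz i j.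
have [s /andP[s0 s1]] : exists2 s : R, 0 < s < 1 &
    h ((x - y) + y) - h y = 'D_(x - y) h (s *: (x - y) + y).
  apply: MVT_line => s s01; apply: diff_derivable; apply: dh; exact: ball_segment.
rewrite subrK !mxE /h => ->.
have B : ball c r (s *: (x - y) + y) by apply: ball_segment => //; rewrite !ltW.
rewrite -derive_coord; last exact: dg.
by rewrite (le_trans (mx_norm_coord _ _ _))// Hg.
Qed.

Lemma evE n (w : form1 R n) x v : ev w x v = \sum_i v 0 i * w x i 0.
Proof. by rewrite /ev mxE. Qed.

Lemma ev_linear n (w : form1 R n) x : linear (ev w x : _ -> R).
Proof. by move=> a u v; rewrite /ev mulmxDl -scalemxAl !mxE. Qed.

Lemma continuous_ev n (w : form1 R n) x : continuous (ev w x : _ -> R).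
Proof.
move=> v; suff : Ck 0 setT (ev w x : _ -> R) by move=> /Ck_continuous; apply.
rewrite (_ : ev w x = fun v => \sum_i v 0 i * w x i 0); last exact/funext/evE.
apply: Ck_sum => [|i]; first exact: openT.
apply: Ck_mul; [exact: openT| |exact: Ck_cst].
exact: (Ck_mxP 0 id openT).1 (Ck_id _ _) 0 i.
Qed.

Lemma ler_norm_ev n (w : form1 R n) x v : `|ev w x v| <= n%:R * `|v| * `|w x|.
Proof. by rewrite (le_trans _ (mx_norm_mul v (w x)))// mx_norm_coord. Qed.

Lemma open_ball_sub X (U : set X) x : open U -> U x ->
  exists2 r : R, 0 < r & ball x r `<=` U.
Proof. by rewrite openE => oU /oU /nbhs_ballP[r r0 H]; exists r. Qed.

(** Continuity of [w] upgrades directional derivatives to a total one: the increment from [x] to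
    [u + x] is [w] at an intermediate point evaluated on [u], and that covector is close to
    [w x]. *)
Lemma differentiable_ev n (f : 'rV[R]_n -> R) (U : set 'rV[R]_n) (w : form1 R n) :
  open U -> Ck 0 U w -> (forall x v, U x -> is_derive x v f (ev w x v)) ->
  forall x, U x -> differentiable f x.
Proof.
move=> oU Cw df x Ux.
pose L : {linear 'rV[R]_n -> R} :=
  HB.pack (ev w x : _ -> R) (GRing.isLinear.Build _ _ _ _ _ (ev_linear w x)).
have [] := @differentiableP_eps _ _ _ f x L _ _; last by [].
  exact: continuous_ev.
(* The factor [n] of [mx_norm_mul] is absorbed here; adding [1] covers [n = 0]. *)
move=> e e0; have e1 : 0 < e / (n%:R + 1) by rewrite divr_gt0// ltr_wpDl.
have /cvgrPdist_le/(_ _ e1) Hw := Ck_continuous Cw Ux.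
have [r1 /= r10 H1] := (nbhs_ballP _ _).1 Hw.
have [r2 r20 H2] := open_ball_sub oU Ux.
have /nbhs_ballP : \forall u \near (0 : 'rV[R]_n), `|u| < Num.min r1 r2.
  by apply: nbhs0_lt; rewrite lt_min r10.
case=> d d0 Hd; apply/nbhs_ballP; exists d => // u /Hd.
rewrite lt_min => /andP[u1 u2].
have B r s : `|u| < r -> 0 <= s <= 1 -> ball x r (s *: u + x).
  move=> ur /andP[s0 s1]; rewrite -ball_normE/= distrC addrK normrZ ger0_norm//.
  by rewrite (le_lt_trans _ ur)// ler_piMl.
have [s /andP[s0 s1]] : exists2 s : R, 0 < s < 1 &
    f (u + x) - f x = 'D_u f (s *: u + x).
  by apply: MVT_line => s s01; have [] := df (s *: u + x) u (H2 _ (B _ _ u2 s01)).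
have s01 : 0 <= s <= 1 by rewrite !ltW.
move=> ->; have [_ ->] := df (s *: u + x) u (H2 _ (B _ _ u2 s01)).
rewrite -[_ - L u]/((u *m w _) 0 0 - (u *m w x) 0 0).
have -> : (u *m w (s *: u + x)) 0 0 - (u *m w x) 0 0 = (u *m (w (s *: u + x) - w x)) 0 0.
  by rewrite mulmxBr !mxE.
rewrite (le_trans (mx_norm_coord _ _ _))// (le_trans (mx_norm_mul _ _))//.
rewrite mulrAC ler_wpM2r// distrC.
rewrite (le_trans (ler_wpM2l _ (H1 _ (B _ _ u1 s01))))//.
have n0 : 0 < n%:R + 1 :> R by rewrite ltr_wpDl.
rewrite mulrCA ler_piMr ?(ltW e0)// ler_pdivrMr// mul1r lerDl//.
Qed.

End MeanValue.

(** * The Poincare lemma *)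

Section Poincare.
Context {R : realType}.
Implicit Types (X Y : normedModType R).

(** Differentiation under the integral sign, dominated by the constant [M], produces the integral of
    [dG 0]; as [dG 0] is itself the derivative of [H], the fundamental theorem of calculus evaluates
    it. *)
Lemma is_derive_integral (G dG : R -> R -> R) (H : R -> R) (e M : R) : 0 < e ->
  (forall h s : R, h \in `]-e, e[ -> s \in `[0, 1] -> is_derive h 1 (G ^~ s) (dG h s)) ->
  (forall h : R, h \in `]-e, e[ -> {within `[0, 1], continuous (G h)}) ->
  (forall h s : R, h \in `]-e, e[ -> s \in `[0, 1] -> `|dG h s| <= M) ->
  (forall s : R, s \in `[0, 1] -> is_derive s 1 H (dG 0 s)) ->
  {within `[0, 1], continuous (dG 0)} ->
  is_derive (0 : R) 1 (fun h => \int[lebesgue_measure]_(s in `[0, 1]) G h s)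
    (H 1 - H 0).
Proof.
move=> e0 dGP Gc dGM dH dGc.
have I0 : (0:R) \in `]-e, e[ by rewrite /= in_itv/= oppr_lt0 e0.
have M0 : 0 <= M by apply: le_trans (dGM 0 0 I0 _) => //=; rewrite in_itv/= lexx ler01.
have d1E (h s : R) : h \in `]-e, e[ -> s \in `[0, 1] -> partial1of2 G h s = dG h s.
  by move=> Ih Is; rewrite partial1of2E; have [_ ->] := dGP h s Ih Is.
have cvgF := @cvg_differentiation_under_integral R _ _ lebesgue_measure G `[0, 1]
  (measurable_itv _) 0 (- e) e I0 _ _ (cst M) (fun=> M0) _ _.
have {}cvgF : h^-1 *: (\int[lebesgue_measure]_(s in `[0, 1]) G (h + 0) s -
    \int[lebesgue_measure]_(s in `[0, 1]) G 0 s) @[h --> 0^'] --> H 1 - H 0.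
  have <- : \int[lebesgue_measure]_(y in `[0, 1]) partial1of2 G 0 y = H 1 - H 0.
    transitivity (\int[lebesgue_measure]_(y in `[0, 1]) dG 0 y).
      by apply: eq_Rintegral => s /set_mem s01; rewrite d1E.
    rewrite /Rintegral (@continuous_FTC2 _ _ H 0 1 ltr01 dGc)//; last first.
      move=> s s01; have := dH s _; rewrite derive1E => /(_ _)[|_ //].
      exact: subset_itv_oo_cc.
    have cH (s : R) : s \in `[0, 1] -> {for s, continuous H}.
      move=> /dH[ds _]; apply: differentiable_continuous.
      exact/derivable1_diffP.
    split=> [s s01||].
    + by have [] := dH s (subset_itv_oo_cc s01).
    + by apply: cvg_at_right_filter; apply: cH; rewrite /= in_itv/= lexx ler01.
    + by apply: cvg_at_left_filter; apply: cH; rewrite /= in_itv/= lexx ler01.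
  apply: cvgF.
  - move=> h Ih; apply: continuous_compact_integrable; first exact: segment_compact.
    exact: Gc.
  - by move=> h s Ih Is; have [] := dGP h s Ih Is.
  - apply: continuous_compact_integrable; first exact: segment_compact.
    by apply: continuous_subspaceT; exact: cst_continuous.
  - by move=> h s Ih Is; rewrite d1E//; exact: dGM.
have E : (fun h : R => h^-1 *: (((fun h => \int[lebesgue_measure]_(s in `[0, 1]) G h s) \o
    shift 0) (h *: 1) - \int[lebesgue_measure]_(s in `[0, 1]) G 0 s)) =
   (fun h => h^-1 *: (\int[lebesgue_measure]_(s in `[0, 1]) G (h + 0) s -
    \int[lebesgue_measure]_(s in `[0, 1]) G 0 s)).
  by apply/funext => h /=; rewrite [h *: 1]mulr1.
split; first by rewrite /derivable E; apply/cvg_ex; exists (H 1 - H 0).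
by rewrite deriveEcvg E; exact: cvg_lim cvgF.
Qed.

Lemma is_derive_coord X m n (M : X -> 'M[R]_(m, n)) x v dM i j :
  is_derive x v M dM -> is_derive x v (fun y => M y i j : R) (dM i j).
Proof.
move=> [dMv <-]; split; first exact: (derivable_mxP _ _ _).1 dMv i j.
by rewrite derive_mx// mxE.
Qed.

Lemma is_derive_dot X n (Q : X -> 'rV[R]_n) (W : X -> 'cV[R]_n) x v dQ dW :
  is_derive x v Q dQ -> is_derive x v W dW ->
  is_derive x v (fun y => (Q y *m W y) 0 0 : R) ((dQ *m W x + Q x *m dW) 0 0).
Proof.
move=> hQ hW.
have hi (i : 'I_n) : is_derive x v (fun y => Q y 0 i * W y i 0 : R)
    (dQ 0 i * W x i 0 + Q x 0 i * dW i 0).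
  have := is_deriveM (is_derive_coord 0 i hQ) (is_derive_coord i 0 hW).
  by move/is_derive_eq; apply; rewrite /GRing.scale/= addrC [W x i 0 * _]mulrC.
have -> : (fun y => (Q y *m W y) 0 0 : R) = \sum_i (fun y => Q y 0 i * W y i 0).
  by apply/funext => y; rewrite mxE fct_sumE.
have -> : (dQ *m W x + Q x *m dW) 0 0 = \sum_i (dQ 0 i * W x i 0 + Q x 0 i * dW i 0).
  by rewrite !mxE big_split.
exact: is_derive_sum.
Qed.

Lemma derive_ev n (w : form1 R n) x u v : differentiable w x ->
  is_derive x u (fun y => ev w y v : R) (ev ('D_u w) x v).
Proof.
move=> /(@diff_derivable _ _ _ _ _ u)/derivableP dw.
have := is_derive_dot (is_derive_cst v x u) dw.
by move/is_derive_eq; apply; rewrite mul0mx add0r.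
Qed.

Lemma Ck_ev n k (U : set 'rV[R]_n) (w : form1 R n) v : open U -> Ck k U w ->
  Ck k U (fun y => ev w y v : R).
Proof.
move=> oU Cw; rewrite (_ : (fun _ => _) = fun y => \sum_i v 0 i * w y i 0).
  apply: Ck_sum => // i; apply: Ck_mul => //; first exact: Ck_cst.
  exact: (Ck_mxP _ _ oU).1 Cw i 0.
by apply/funext => y; rewrite evE.
Qed.

Lemma Ck0_bounded X Y (U : set X) (f : X -> Y) x : Ck 0 U f -> U x ->
  exists2 C : R, 0 <= C & \forall y \near x, `|f y| <= C.
Proof.
move=> Cf Ux; exists (`|f x| + 1); first by rewrite addr_ge0.
have /cvgrPdist_le/(_ _ ltr01) H := Ck_continuous Cf Ux.
near=> y; rewrite -lerBlDl (le_trans (lerB_dist _ _))// distrC.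
by near: y.
Unshelve. all: by end_near. Qed.

(** The primitive is the radial integral, for [s] from 0 to 1, of [w] at [x0 + s u] evaluated on
    [u = x - x0]. Once closedness has exchanged two directions, the derivative of the integrand
    along [v] is the [s]-derivative of [s] times [w] at [x0 + s u] evaluated on [v], and the
    boundary values give [ev w x v]. *)
Lemma closed_form_primitive n (w : form1 R n) (D : set 'rV[R]_n) x0 :
  open D -> D x0 -> Ck 1 D w -> (forall x v v', D x -> dform w x v v' = 0) ->
  exists r f, [/\ 0 < r, ball x0 r `<=` D &
    forall x v, ball x0 r x -> is_derive x v (f : _ -> R) (ev w x v)].
Proof.
move=> oD Dx0 Cw cl.
have dw x : D x -> differentiable w x by exact: Ck_diff Cw.
(* One bound for [w] and its partial derivatives near [x0]; it supplies the constant that dominates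
   the differentiated integrand. *)
have [C [C0 HC]] : exists C : R, 0 <= C /\
    \forall y \near x0, `|w y| <= C /\ forall i, `|'D_(delta_mx 0 i) w y| <= C.
  have [C1 C10 H1] := Ck0_bounded (CkW Cw) Dx0.
  have H2 (i : 'I_n) : exists C : R, 0 <= C /\ \forall y \near x0, `|'D_(delta_mx 0 i) w y| <= C.
    by have [c] := Ck0_bounded (Ck_D (delta_mx 0 i) Cw) Dx0; exists c.
  have [C2 {}H2] := choice H2.
  have C20 : 0 <= \sum_i C2 i by apply: sumr_ge0 => i _; exact: (H2 i).1.
  exists (C1 + \sum_i C2 i); split; first by rewrite addr_ge0.
  have H3 : \forall y \near x0, forall i, `|'D_(delta_mx 0 i) w y| <= C2 i.
    by near=> y; move=> i; move: i; near: y; apply: filter_forall => i /=; exact: (H2 i).2.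
  have H4 y : `|w y| <= C1 -> (forall i, `|'D_(delta_mx 0 i) w y| <= C2 i) ->
      `|w y| <= C1 + \sum_i C2 i /\
      forall i, `|'D_(delta_mx 0 i) w y| <= C1 + \sum_i C2 i.
    move=> y1 y2; split=> [|i]; first by apply: (le_trans y1); rewrite lerDl.
    apply: (le_trans (y2 i)); rewrite ler_wpDl// (bigD1 i)//= lerDl.
    by apply: sumr_ge0 => j _; exact: (H2 j).1.
  by near=> y; apply: H4; near: y.
have [r1 r10 H1] := (nbhs_ballP _ _).1 HC.
have [r2 r20 H2] := open_ball_sub oD Dx0.
pose r := Num.min r1 r2.
have r0 : 0 < r by rewrite lt_min r10.
have Dr y : ball x0 r y -> D y.
  by move=> yr; apply: H2; apply: le_ball yr; rewrite ge_min lexx orbT.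
have wC y : ball x0 r y -> `|w y| <= C.
  by move=> yr; apply: (H1 y _).1; apply: le_ball yr; rewrite ge_min lexx.
have dwC y v : ball x0 r y -> `|'D_v w y| <= n%:R * `|v| * C.
  move=> yr; rewrite (derive_row _ (dw _ (Dr _ yr))) (le_trans (ler_norm_sum _ _ _))//.
  rewrite (@le_trans _ _ (\sum_(i < n) `|v| * C))//.
    apply: ler_sum => i _; rewrite normrZ ler_pM ?mx_norm_coord//.
    by apply: (H1 y _).2; apply: le_ball yr; rewrite ge_min lexx.
  by rewrite sumr_const card_ord -[leLHS]mulr_natl mulrA.
pose f x := \int[lebesgue_measure]_(s in `[0, 1]) ev w (s *: (x - x0) + x0) (x - x0).
exists r, f; split => // x v xr.
pose u := x - x0; have ur : `|u| < r by move: xr; rewrite -ball_normE/= distrC.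
(* For [h] in []-e, e[] the vector [h *: v + u] stays shorter than [r], so the whole radial segment
   remains in the ball. *)
pose e := (r - `|u|) / (`|v| + 1).
have v1 : 0 < `|v| + 1 by rewrite ltr_wpDl.
have e0 : 0 < e by rewrite divr_gt0// subr_gt0.
have qr (h : R) : h \in `]-e, e[ -> `|h *: v + u| < r.
  rewrite in_itv/= -ltr_norml => he.
  rewrite (le_lt_trans (ler_normD _ _))// normrZ -ltrBrDr.
  rewrite (@le_lt_trans _ _ (`|h| * (`|v| + 1)))//; first by rewrite ler_wpM2l// lerDl.
  by rewrite -ltr_pdivlMr.
have pr (q : 'rV[R]_n) (s : R) : `|q| < r -> s \in `[0, 1] -> ball x0 r (s *: q + x0).
  move=> q_r; rewrite in_itv/= => /andP[s0 s1].
  rewrite -ball_normE/= distrC addrK normrZ ger0_norm//.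
  by rewrite (le_lt_trans _ q_r)// ler_piMl.
pose G (h s : R) := ev w (s *: (h *: v + u) + x0) (h *: v + u).
pose dG (h s : R) := s * ev ('D_v w) (s *: (h *: v + u) + x0) (h *: v + u) +
  ev w (s *: (h *: v + u) + x0) v.
pose H (s : R) := s * ev w (s *: u + x0) v.
have is_line (a b : 'rV[R]_n) (t : R) : is_derive t 1 (fun t : R => t *: a + b) a.
  have [] := is_derive_id (t *: a + b) a => /is_derive_line.
  by move=> + E; rewrite E.
have wline (q a : 'rV[R]_n) (t : R) : D (t *: a + q) ->
    is_derive t 1 (fun t : R => w (t *: a + q)) ('D_a w (t *: a + q)).
  by move=> Dq; apply: is_derive_line; apply: diff_derivable; exact: dw.
have : is_derive (0 : R) 1 (fun h => \int[lebesgue_measure]_(s in `[0, 1]) G h s)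
    (H 1 - H 0).
  apply: (@is_derive_integral G dG H e (n%:R * r * (n%:R * `|v| * C) + n%:R * `|v| * C)) => //.
  - move=> h s he s01.
    have E t : s *: (t *: v + u) + x0 = t *: (s *: v) + (s *: u + x0).
      by rewrite scalerDr !scalerA [s * t]mulrC addrA.
    have Dp := Dr _ (pr _ _ (qr _ he) s01).
    have := Dp; rewrite E => /wline/(is_derive_dot (is_line v u h)).
    under [fun y => (_ *m _) 0 0]eq_fun do rewrite -E.
    move/is_derive_eq; apply.
    rewrite -E (deriveZv _ _ (dw _ Dp)) /dG /ev mxE -scalemxAr addrC; congr (_ + _).
    by rewrite mxE.
  - move=> h he; apply: derivable_within_continuous => s s01.
    have Dp := Dr _ (pr _ _ (qr _ he) s01).
    have := is_derive_dot (is_derive_cst (h *: v + u) s 1) (wline _ _ _ Dp).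
    by case.
  - move=> h s he s01; have xp := pr _ _ (qr _ he) s01.
    rewrite (le_trans (ler_normD _ _))// lerD//.
      rewrite normrM -[leRHS]mul1r ler_pM//.
        by move: s01; rewrite in_itv/= => /andP[s0 s1]; rewrite ger0_norm.
      rewrite (le_trans (ler_norm_ev _ _ _))// ler_pM ?mulr_ge0//; last exact: dwC.
      by rewrite ler_wpM2l// ltW// qr.
    rewrite (le_trans (ler_norm_ev _ _ _))// ler_wpM2l ?mulr_ge0//; exact: wC.
  - move=> s s01; have xp := Dr _ (pr u s ur s01).
    have := is_deriveM (is_derive_id s 1)
      (is_derive_dot (is_derive_cst v s 1) (wline _ _ _ xp)).
    move/is_derive_eq; apply.
    (* Closedness enters here: differentiating [w] along [u] and evaluating on [v] may be replaced
       by the opposite. *)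
    have key : ev ('D_u w) (s *: u + x0) v = ev ('D_v w) (s *: u + x0) u.
      apply/esym/eqP; rewrite -subr_eq0.
      have := cl _ v u xp; rewrite /dform.
      have [_ ->] := derive_ev v u (dw _ xp).
      by have [_ ->] := derive_ev u v (dw _ xp) => ->.
    rewrite mul0mx add0r /dG scale0r add0r -key; congr (_ + _); exact: mulr1.
  - apply/continuous_in_subspaceT => s /set_mem s01.
    have xp := Dr _ (pr u s ur s01).
    have lc : {for s, continuous (fun s : R => s *: u + x0)}.
      have [ds _] := is_line u x0 s.
      exact/differentiable_continuous/derivable1_diffP.
    have lim0 (w0 : form1 R n) z : Ck 0 D w0 ->
        {for s, continuous (fun s : R => ev w0 (s *: u + x0) z)}.
      move=> /(Ck_ev z oD) /Ck_continuous /(_ xp) c0.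
      exact: (continuous_comp lc c0).
    rewrite /dG scale0r add0r.
    apply: cvgD; last exact: lim0 (CkW Cw).
    by apply: cvgM; [exact: cvg_id|exact: lim0 (Ck_D v Cw)].
rewrite /H scale1r mul1r mul0r subr0 /u subrK => df; apply: is_derive_along.
have E : (fun h : R => f (h *: v + x)) =
    (fun h => \int[lebesgue_measure]_(s in `[0, 1]) G h s).
  by apply/funext => h; rewrite /f /G /u addrA.
rewrite E; exact: df.
Unshelve. all: by end_near. Qed.

(** The directional derivatives of the primitive are the smooth functions [ev w x v];
    [differentiable_ev] supplies the total differentiability of [f] itself. *)
Lemma smooth_closed_form_primitive n (w : form1 R n) (D : set 'rV[R]_n) x0 :
  open D -> D x0 -> smooth_on D w ->
  (forall x v v', D x -> dform w x v v' = 0) ->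
  exists r f, [/\ 0 < r, ball x0 r `<=` D, smooth_on (ball x0 r) (f : _ -> R) &
    forall x v, ball x0 r x -> 'D_v f x = ev w x v].
Proof.
move=> oD Dx0 Cw cl.
have [r [f [r0 rD fP]]] := closed_form_primitive oD Dx0 (Cw 1) cl.
have oB : open (ball x0 r) by exact: ball_open.
have Cwb k : Ck k (ball x0 r) w by apply: Ck_sub (Cw k).
have df := differentiable_ev oB (Cwb 0) fP.
have Df x v : ball x0 r x -> 'D_v f x = ev w x v by move=> /(fP x v)[].
exists r, f; split=> // k; case: k => [|k].
  by move=> x Bx; exact/differentiable_continuous/df.
split=> // v; apply: (@Ck_eq _ _ _ _ _ (fun x => ev w x v)) => // [x Bx|].
  by rewrite Df.
exact: Ck_ev.
Qed.

End Poincare.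

(** * The inverse function theorem *)

Section InverseFunction.
Context {R : realType}.
Implicit Types (X Y : normedModType R).

Lemma row_contraction_fixed_point n (U : set 'rV[R]_n) (g : 'rV[R]_n -> 'rV[R]_n) (q : R) :
  0 <= q < 1 -> closed U -> U !=set0 -> (forall x, U x -> U (g x)) ->
  (forall x y, U x -> U y -> `|g x - g y| <= q * `|x - y|) ->
  exists2 p, U p & p = g p.
Proof.
move=> /andP[q0 q1] cU U0 Ug gq.
(* Banach's theorem asks for one structure that is both normed and complete; [T] joins the two
   carried by row vectors. *)
pose T : completeNormedModType R := HB.pack_for (completeNormedModType R) 'rV[R]_n
  (NormedModule.on 'rV[R]_n) (Complete.on 'rV[R]_n).
pose f := @mkfun_fun T T U U g Ug.
apply: (@banach_fixed_point R T U f) => //.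
by exists (NngNum q0); split => //= -[x y] [/= Ux Uy]; exact: gq.
Qed.

Lemma Ck_det X n k (U : set X) (A : X -> 'M[R]_n) : open U ->
  (forall i j, Ck k U (fun x => A x i j : R)) -> Ck k U (fun x => \det (A x) : R).
Proof.
move=> oU CA; apply: Ck_sum => // s; apply: Ck_mul => //; first exact: Ck_cst.
exact: Ck_prod.
Qed.

(** By Cramer's rule each entry is a cofactor, polynomial in the entries, times the inverse of the
    nonvanishing determinant. *)
Lemma Ck_invmx X n k (U : set X) (A : X -> 'M[R]_n) : open U ->
  (forall x, U x -> A x \in unitmx) ->
  (forall i j, Ck k U (fun x => A x i j : R)) ->
  forall i j, Ck k U (fun x => invmx (A x) i j : R).
Proof.
move=> oU uA CA i j.
apply: (@Ck_eq _ _ _ _ _ (fun x => (\det (A x))^-1 *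
    ((-1) ^+ (j + i) * \det (row' j (col' i (A x)))))) => // [x Ux|].
  by rewrite /invmx uA// !mxE.
apply: Ck_mul => //.
  apply: Ck_inv => // [x Ux|]; last exact: Ck_det.
  by rewrite -unitfE -[_ \is a _]/(A x \in unitmx) uA.
apply: Ck_mul => //; first exact: Ck_cst.
apply: Ck_det => // i' j'.
by apply: (@Ck_eq _ _ _ _ _ (fun x => A x (lift j i') (lift i j'))) => // x _; rewrite !mxE.
Qed.

(** Transpose of the usual Jacobian matrix: tangent vectors are rows and matrices act on the
    right. *)
Definition jac n (psi : 'rV[R]_n -> 'rV[R]_n) x : 'M[R]_n :=
  \matrix_(i, j) 'D_(delta_mx 0 i) psi x 0 j.

Lemma derive_jac n (psi : 'rV[R]_n -> 'rV[R]_n) x v : differentiable psi x ->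
  'D_v psi x = v *m jac psi x.
Proof.
move=> dpsi; rewrite (derive_row _ dpsi); apply/rowP => j.
by rewrite summxE mxE; apply: eq_bigr => i _; rewrite !mxE.
Qed.

Lemma jac_unit n (psi : 'rV[R]_n -> 'rV[R]_n) x : differentiable psi x ->
  (forall v, 'D_v psi x = 0 -> v = 0) -> jac psi x \in unitmx.
Proof.
move=> dpsi inj; rewrite -row_free_unit; apply/row_freeP.
have : row_free (jac psi x).
  rewrite -kermx_eq0; apply/rowV0P => v /sub_kermxP vJ; apply: inj.
  by rewrite derive_jac.
by move=> /row_freeP.
Qed.

Lemma continuous_mulmxr n p (M : 'M[R]_(n, p)) :
  continuous (mulmxr M : 'rV[R]_n -> 'rV[R]_p).
Proof.
move=> v; suff : Ck 0 setT (fun v : 'rV[R]_n => v *m M) by move=> /Ck_continuous; apply.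
apply/(Ck_mxP _ _ openT) => i j.
apply: (@Ck_eq _ _ _ _ _ (fun v : 'rV[R]_n => \sum_k v i k * M k j : R)); first exact: openT.
  by move=> x _; rewrite mxE.
apply: Ck_sum => [|k]; first exact: openT.
apply: Ck_mul; [exact: openT| |exact: Ck_cst].
exact: (Ck_mxP 0 id openT).1 (Ck_id _ _) i k.
Qed.

(** With [h = chi (k + y) - chi y] and [J = jac psi (chi y)], the error [h - k M] equals
    [- (k - h J) M]. The expansion of [psi] makes [k - h J] negligible against [h], and the
    Lipschitz bound makes it negligible against [k]. *)
Lemma inverse_function_differentiable n (psi chi : 'rV[R]_n -> 'rV[R]_n)
    (N' : set 'rV[R]_n) (K : R) y : open N' -> N' y -> 0 <= K ->
  (forall z z', N' z -> N' z' -> `|chi z - chi z'| <= K * `|z - z'|) ->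
  (forall z, N' z -> psi (chi z) = z) ->
  differentiable psi (chi y) -> jac psi (chi y) \in unitmx ->
  differentiable chi y /\
  forall v, 'D_v chi y = v *m invmx (jac psi (chi y)).
Proof.
move=> oN' Ny K0 lip can dpsi uJ.
pose M := invmx (jac psi (chi y)).
have [dchi dE] : differentiable chi y /\ 'd chi y = mulmxr M :> (_ -> _).
  apply: differentiableP_eps => [|e e0]; first exact: continuous_mulmxr.
  (* The losses of the estimate: [n] and the norm of [M] come from the matrix product, [K] from the
     Lipschitz bound. *)
  have c0 : 0 < n%:R * K * `|M| + 1 by rewrite ltr_wpDl// !mulr_ge0.
  have e1 : 0 < e / (n%:R * K * `|M| + 1) by rewrite divr_gt0.
  have /eqaddoP/(_ _ e1) Hpsi : psi \o shift (chi y) =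
      cst (psi (chi y)) + 'd psi (chi y) +o_ (0 : 'rV[R]_n) id.
    by have /diff_locallyP[] := dpsi.
  have [d /= d0 Hd] := (nbhs_ballP _ _).1 Hpsi.
  have [r r0 Hr] := open_ball_sub oN' Ny.
  have m0 : 0 < Num.min r (d / (K + 1)) by rewrite lt_min r0 divr_gt0// ltr_wpDl.
  apply/nbhs_ballP; exists (Num.min r (d / (K + 1))) => // k.
  rewrite -ball_normE/= sub0r normrN lt_min => /andP[kr kd].
  have Nk : N' (k + y) by apply: Hr; rewrite -ball_normE/= distrC addrK.
  pose h := chi (k + y) - chi y.
  have hk : `|h| <= K * `|k| by have := lip _ _ Nk Ny; rewrite addrK.
  have hd : ball 0 d h.
    rewrite -ball_normE/= sub0r normrN (le_lt_trans hk)//.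
    rewrite (@le_lt_trans _ _ ((K + 1) * `|k|))// ?ler_wpM2r ?lerDl//.
    by rewrite mulrC -ltr_pdivlMr// ltr_wpDl.
  have := Hd _ hd.
  have -> : (psi \o shift (chi y) - (cst (psi (chi y)) + 'd psi (chi y))) h =
      k - h *m jac psi (chi y).
    rewrite !fctE /= /h subrK can// can// -derive_jac// deriveE//.
    by rewrite opprD addrA addrK.
  move=> Hk.
  suff : `|h - k *m M| <= e * `|k| by [].
  have -> : h - k *m M = - ((k - h *m jac psi (chi y)) *m M).
    by rewrite mulmxBl mulmxK// opprB.
  rewrite normrN (le_trans (mx_norm_mul _ _))//.
  have Hk2 := le_trans Hk (ler_wpM2l (ltW e1) hk).
  apply: (@le_trans _ _ (n%:R * (e / (n%:R * K * `|M| + 1) * (K * `|k|)) * `|M|)).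
    by rewrite ler_wpM2r// ler_wpM2l.
  rewrite (_ : _ * _ * _ = e * `|k| * ((n%:R * K * `|M|) / (n%:R * K * `|M| + 1))).
    by rewrite ler_piMr ?mulr_ge0 ?(ltW e0)// ler_pdivrMr// mul1r lerDl.
  by move: (_^-1) => z; ring.
by split=> // v; rewrite (deriveE _ dchi) dE.
Qed.

(** Bootstrap: the derivative of [chi] is a smooth function of [chi], so each order of regularity
    yields the next. *)
Lemma Ck_inverse n (psi chi : 'rV[R]_n -> 'rV[R]_n) (N N' : set 'rV[R]_n) :
  open N -> open N' -> smooth_on N psi ->
  (forall x, N x -> jac psi x \in unitmx) -> (forall y, N' y -> N (chi y)) ->
  (forall y, N' y -> differentiable chi y) ->
  (forall y v, N' y -> 'D_v chi y = v *m invmx (jac psi (chi y))) ->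
  smooth_on N' chi.
Proof.
move=> oN oN' spsi uJ NN dchi Dchi; elim=> [|k IH].
  by move=> y Ny; exact/differentiable_continuous/dchi.
split=> // v.
apply: (@Ck_eq _ _ _ _ _ (fun y => v *m invmx (jac psi (chi y)))) => //.
  by move=> y Ny; rewrite Dchi.
apply/(Ck_mxP _ _ oN') => i j.
apply: (@Ck_eq _ _ _ _ _ (fun y => \sum_l v i l * invmx (jac psi (chi y)) l j)) => //.
  by move=> y _; rewrite mxE.
apply: Ck_sum => // l; apply: Ck_mul => //; first exact: Ck_cst.
apply: (Ck_comp (g := fun x => invmx (jac psi x) l j) oN' NN IH).
apply: Ck_invmx => // i' j'.
apply: (@Ck_eq _ _ _ _ _ (fun x => 'D_(delta_mx 0 i') psi x 0 j')) => //.
  by move=> x _; rewrite mxE.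
by apply: ((Ck_mxP _ _ oN).1 (Ck_D _ (spsi k.+1))).
Qed.

(* Banach's fixed point theorem is applied to the maps [g y], whose fixed points
   are the solutions of [psi x = y]. *)
Lemma inverse_function n (psi : 'rV[R]_n -> 'rV[R]_n) (D : set 'rV[R]_n) t :
  open D -> D t -> smooth_on D psi ->
  (forall x v, D x -> 'D_v psi x = 0 -> v = 0) ->
  exists (N N' : set 'rV[R]_n) (chi : 'rV[R]_n -> 'rV[R]_n),
    [/\ open N, open N', N t & N `<=` D] /\
    [/\ smooth_on N' chi, (forall s, N s -> N' (psi s)),
      (forall y, N' y -> N (chi y)), (forall s, N s -> chi (psi s) = s) &
      (forall y, N' y -> psi (chi y) = y)].
Proof.
move=> oD Dt spsi inj.
have dpsi x : D x -> differentiable psi x by exact: Ck_diff (spsi 1).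
have uJ x : D x -> jac psi x \in unitmx.
  by move=> Dx; apply: jac_unit; [exact: dpsi|move=> v; exact: inj].
pose L := invmx (jac psi t).
have c2 : 0 < 2 * (n%:R + 1) :> R by rewrite mulr_gt0// ltr_wpDl.
(* After the factor [n] of [mx_norm_mul], this bound makes every [g y] a contraction of ratio 1/2 on
   the ball. *)
have [r [r0 rD HJ]] : exists r : R, [/\ 0 < r, ball t r `<=` D &
    forall x, ball t r x -> `|1%:M - jac psi x *m L| <= (2 * (n%:R + 1))^-1].
  have Cm : Ck 0 D (fun x => 1%:M - jac psi x *m L).
    apply/(Ck_mxP _ _ oD) => i j.
    apply: (@Ck_eq _ _ _ _ _ (fun x => (1%:M : 'M[R]_n) i j -
      \sum_k 'D_(delta_mx 0 i) psi x 0 k * L k j)) => //.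
      by move=> x _; rewrite !mxE; congr (_ - _); apply: eq_bigr => k _; rewrite mxE.
    apply: Ck_add => //; first exact: Ck_cst.
    apply: Ck_opp => //; apply: Ck_sum => // k; apply: Ck_mul => //; last exact: Ck_cst.
    exact: (Ck_mxP _ _ oD).1 (Ck_D _ (spsi 1)) 0 k.
  have e0 : 0 < (2 * (n%:R + 1))^-1 :> R by rewrite invr_gt0.
  have /cvgrPdist_le/(_ _ e0) H := Ck_continuous Cm Dt.
  have [r1 /= r10 H1] := (nbhs_ballP _ _).1 H.
  have [r2 r20 H2] := open_ball_sub oD Dt.
  exists (Num.min r1 r2); split; first by rewrite lt_min r10.
    by move=> x xr; apply: H2; apply: le_ball xr; rewrite ge_min lexx orbT.
  move=> x xr; have : ball t r1 x by apply: le_ball xr; rewrite ge_min lexx.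
  by move/H1; rewrite mulmxV; [rewrite subrr sub0r normrN|exact: uJ].
pose g y x := x - (psi x - y) *m L.
have dg y x : D x -> differentiable (g y) x /\
    forall v, 'D_v (g y) x = v *m (1%:M - jac psi x *m L).
  move=> Dx.
  have dx := dpsi _ Dx.
  have dL : differentiable (mulmxr L : 'rV[R]_n -> 'rV[R]_n) (psi x).
    exact/linear_differentiable/continuous_mulmxr.
  have dh := differentiable_comp dx dL.
  have gE : g y = (id - (mulmxr L \o psi)) + cst (y *m L).
    by apply/funext => z; rewrite /g !fctE /= mulmxBl opprB addrA addrAC.
  have did : differentiable (id : 'rV[R]_n -> 'rV[R]_n) x by exact: ex_diff.
  have d1 := differentiableB did dh.
  rewrite gE; split; first exact: (differentiableD d1 (differentiable_cst _ _)).
  move=> v; rewrite (deriveD (diff_derivable d1) (derivable_cst _ _ v)).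
  rewrite derive_cst addr0 (deriveB (diff_derivable did) (diff_derivable dh)).
  rewrite derive_id (derive_comp v dx dL) (deriveE _ dL) diff_lin; last exact: continuous_mulmxr.
  by rewrite /= (derive_jac _ dx) mulmxBr mulmx1 mulmxA.
have gC y x x' : ball t r x -> ball t r x' -> `|g y x - g y x'| <= 2^-1 * `|x - x'|.
  apply: derive_lipschitz => [|z /rD /(dg y)[] //|z v Bz]; first by rewrite invr_ge0.
  have [_ ->] := dg y z (rD _ Bz).
  rewrite (le_trans (mx_norm_mul _ _))// mulrAC ler_wpM2r//.
  rewrite (le_trans (ler_wpM2l _ (HJ _ Bz)))// invfM mulrCA ler_piMr ?invr_ge0//.
  by rewrite ler_pdivrMr ?ltr_wpDl// mul1r lerDl.
(* In [x - x' = (g 0 x - g 0 x') + (psi x - psi x') L] the first bracket absorbs half of the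
   left-hand side; hence the factor 2. *)
pose K := 2 * (n%:R * `|L|).
have K0 : 0 <= K by rewrite !mulr_ge0.
have lip x x' : ball t r x -> ball t r x' -> `|x - x'| <= K * `|psi x - psi x'|.
  move=> Bx Bx'.
  have E : x - x' = (g 0 x - g 0 x') + (psi x - psi x') *m L.
    rewrite /g !subr0 mulmxBl opprB [x - _ + _]addrC -addrA subrKA addrC.
    by rewrite subrKA.
  have := ler_normD (g 0 x - g 0 x') ((psi x - psi x') *m L); rewrite -E.
  have := gC 0 x x' Bx Bx'; have := mx_norm_mul (psi x - psi x') L.
  rewrite [n%:R * _ * _]mulrAC /K.
  move: (`|x - x'|) (`|psi _ - _|) (`|_ *m L|) (`|g _ _ - _|) (n%:R * `|L|) => a b c d e.
  lra.
have r20 : 0 < r / 2 by rewrite divr_gt0.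
(* For [y] within [rho] of [psi t], [g y] moves [t] by less than [r / 4], and the contraction adds
   at most [r / 4]; the closed ball of radius [r / 2] is thus mapped into the open one. *)
pose rho := r / 2 / 2 / (n%:R * `|L| + 1).
have L1 : 0 < n%:R * `|L| + 1 by rewrite ltr_wpDl// mulr_ge0.
have rho0 : 0 < rho by rewrite !divr_gt0.
pose N' := ball (psi t) rho.
pose N := [set x | ball t (r / 2) x /\ N' (psi x)].
have sub x : `|t - x| <= r / 2 -> ball t r x.
  move=> h; rewrite -ball_normE/= (le_lt_trans h)//.
  by rewrite ltr_pdivrMr// ltr_pMr// ltr1n.
have Bt : ball t r t by exact: ballxx.
have gt_lt y : N' y -> `|g y t - t| < r / 2 / 2.
  rewrite /N' -ball_normE/= => Ny; rewrite /g addrAC subrr add0r normrN.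
  rewrite (le_lt_trans (mx_norm_mul _ _))// mulrAC.
  rewrite (@le_lt_trans _ _ (`|psi t - y| * (n%:R * `|L| + 1)))//.
    by rewrite mulrC ler_wpM2l// lerDl.
  by rewrite -ltr_pdivlMr.
have g_near y x : N' y -> `|t - x| <= r / 2 -> `|t - g y x| < r / 2.
  move=> Ny tx; have := gC y x t (sub _ tx) Bt; have := gt_lt y Ny.
  have := ler_distD (g y t) (g y x) t; rewrite [`|t - g y x|]distrC.
  rewrite [`|x - t|]distrC => h1 h2 h3.
  move: h1 h2 h3 tx; move: (`|g y x - t|) (`|_ - g y t|) (`|_ - t|) (`|t - x|) => a b c d.
  lra.
(* Outside [N'] the default value [t] makes [chi] a total function. *)
have ex y : exists x, N' y -> ball t (r / 2) x /\ psi x = y.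
  have [Ny|] := pselect (N' y); last by exists t.
  have [|||||p Up pE] := @row_contraction_fixed_point n
    (closed_ball_ Num.Def.normr t (r / 2)) (g y) 2^-1.
  - by rewrite invr_ge0 ler0n invf_lt1// ltr1n.
  - exact: closed_closed_ball_.
  - by exists t; rewrite /closed_ball_/= subrr normr0 ltW.
  - by move=> x /(g_near _ _ Ny)/ltW.
  - by move=> x x' Ux Ux'; apply: gC; exact: sub.
  exists p => _; split; first by rewrite -ball_normE/= pE; exact: g_near.
  apply/eqP; rewrite -subr_eq0; apply/eqP.
  have : (psi p - y) *m L = 0.
    by rewrite -[LHS](subKr p) -/(g y p) -pE subrr.
  move=> /(congr1 (mulmx^~ (jac psi t))).
  by rewrite mul0mx -mulmxA mulVmx ?uJ// mulmx1.
have [chi chiP] := choice ex.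
have r2r x : ball t (r / 2) x -> ball t r x.
  by apply: le_ball; rewrite ler_pdivrMr// ler_pMr// ler1n.
have oN : open N.
  rewrite openE => x [Bx Nx].
  have cx : {for x, continuous psi} by apply/differentiable_continuous/dpsi/rD/r2r.
  have n1 : nbhs x (ball t (r / 2)) by apply: open_nbhs_nbhs; split => //; exact: ball_open.
  have n2 : nbhs x (psi @^-1` N').
    by apply: cx; apply: open_nbhs_nbhs; split => //; exact: ball_open.
  exact: filterI n1 n2.
have oN' : open N' by exact: ball_open.
have Nchi y : N' y -> N (chi y).
  by move=> Ny; have [h1 h2] := chiP _ Ny; split=> //; rewrite h2.
have psichi y : N' y -> psi (chi y) = y by move=> /chiP[].
have ND x : N x -> D x by move=> [/r2r/rD].
have dchi y : N' y -> differentiable chi y /\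
    forall v, 'D_v chi y = v *m invmx (jac psi (chi y)).
  move=> Ny; have Dc := ND _ (Nchi _ Ny).
  apply: (inverse_function_differentiable oN' Ny K0) => //; [|exact: dpsi|exact: uJ].
  move=> z z' Nz Nz'; have := lip (chi z) (chi z'); rewrite !psichi//; apply.
    by apply: r2r; have [] := chiP _ Nz.
  by apply: r2r; have [] := chiP _ Nz'.
exists N, N', chi; split; split=> //.
- by split; exact: ballxx.
- apply: (@Ck_inverse _ psi chi N N') => //.
  + by move=> k; apply: Ck_sub (spsi k).
  + by move=> x /ND /uJ.
  + by move=> y /dchi[].
  + by move=> y v /dchi[].
- by move=> s [].
- move=> s [s1 s2]; apply/eqP; rewrite -subr_eq0 -normr_le0.
  have := lip (chi (psi s)) s; rewrite psichi// subrr normr0 mulr0; apply.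
    by apply: r2r; have [] := chiP _ s2.
  exact: r2r.
Qed.

End InverseFunction.

(** * Pull-back of forms *)

Section Pullback.
Context {R : realType}.
Implicit Types (X Y : normedModType R).

(** [pull1] is only a function of the vector; storing its values on the standard basis gives a
    genuine form on the parameter domain, on which [dform] and [wedge] act. *)
Definition pullback m n (phi : 'rV[R]_m -> 'rV[R]_n) (w : form1 R n) : form1 R m :=
  fun t => \col_i pull1 phi w t (delta_mx 0 i).

Lemma evDv n (w : form1 R n) x u v : ev w x (u + v) = ev w x u + ev w x v.
Proof. by rewrite /ev mulmxDl mxE. Qed.

Lemma evZv n (w : form1 R n) x a v : ev w x (a *: v) = a * ev w x v.
Proof. by rewrite /ev -scalemxAl mxE. Qed.

Lemma ev_sumv n (I : finType) (w : form1 R n) x (v : I -> 'rV[R]_n) :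
  ev w x (\sum_i v i) = \sum_i ev w x (v i).
Proof. by rewrite /ev mulmx_suml summxE. Qed.

Lemma ev_delta n (w : form1 R n) x i : ev w x (delta_mx 0 i) = w x i 0.
Proof. by rewrite /ev -rowE mxE. Qed.

Lemma ev_pullback m n (phi : 'rV[R]_m -> 'rV[R]_n) (w : form1 R n) t v :
  differentiable phi t -> ev (pullback phi w) t v = ev w (phi t) ('D_v phi t).
Proof.
move=> dphi; rewrite (derive_row _ dphi) ev_sumv evE.
by apply: eq_bigr => i _; rewrite evZv mxE.
Qed.

Lemma Ck_form n k X (U : set X) (w : X -> 'cV[R]_n) : open U ->
  (forall i, Ck k U (fun x => w x i 0 : R)) -> Ck k U w.
Proof. by move=> oU H; apply/(Ck_mxP _ _ oU) => i j; rewrite (ord1 j). Qed.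

Lemma Ck_coord n k X (U : set X) (w : X -> 'cV[R]_n) i : open U ->
  Ck k U w -> Ck k U (fun x => w x i 0 : R).
Proof. by move=> oU /(Ck_mxP _ _ oU); apply. Qed.

Lemma smooth_pullback m n (phi : 'rV[R]_m -> 'rV[R]_n) (w : form1 R n)
    (D : set 'rV[R]_m) (U : set 'rV[R]_n) :
  open D -> open U -> (forall t, D t -> U (phi t)) ->
  smooth_on D phi -> smooth_on U w -> smooth_on D (pullback phi w).
Proof.
move=> oD oU DU sphi sw k; apply: Ck_form => // i.
apply: (@Ck_eq _ _ _ _ _
  (fun t => \sum_j 'D_(delta_mx 0 i) phi t 0 j * w (phi t) j 0)) => //.
  by move=> t _; rewrite mxE /pull1 evE.
apply: Ck_sum => // j; apply: Ck_mul => //.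
  exact: (Ck_mxP _ _ oD).1 (Ck_D _ (sphi k.+1)) 0 j.
exact: (Ck_comp (g := fun x => w x j 0) oD DU (sphi k) (Ck_coord j oU (sw k))).
Qed.

Lemma dform_ev n (w : form1 R n) x v v' : differentiable w x ->
  dform w x v v' = ev ('D_v w) x v' - ev ('D_v' w) x v.
Proof.
move=> dw; rewrite /dform.
by have [_ ->] := derive_ev v v' dw; have [_ ->] := derive_ev v' v dw.
Qed.

Lemma derive_commute_row m n (phi : 'rV[R]_m -> 'rV[R]_n) (D : set 'rV[R]_m) t v w :
  open D -> D t -> Ck 2 D phi -> 'D_v ('D_w phi) t = 'D_w ('D_v phi) t.
Proof.
move=> oD Dt Cphi; apply/rowP => j.
have H (u u' : 'rV[R]_m) : 'D_u ('D_u' phi) t 0 j =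
    'D_u ('D_u' (fun y => phi y 0 j : R)) t.
  rewrite (derive_coord _ _ _ (Ck_diff (Ck_D u' Cphi) Dt)).
  apply: near_eq_derive; have [r r0 rD] := open_ball_sub oD Dt.
  apply/nbhs_ballP; exists r => // y /rD Dy.
  exact: (derive_coord _ _ _ (Ck_diff Cphi Dy)).
apply: (etrans (H v w)); apply: etrans (esym (H w v)).
exact: (derive_commute v w oD Dt ((Ck_mxP _ _ oD).1 Cphi 0 j)).
Qed.

(** Second derivatives of [phi] also appear when the pulled-back form is differentiated; being
    symmetric in the two directions, they cancel in the alternation. *)
Lemma dform_pullback m n (phi : 'rV[R]_m -> 'rV[R]_n) (w : form1 R n)
    (D : set 'rV[R]_m) t v v' :
  open D -> D t -> Ck 2 D phi -> differentiable w (phi t) ->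
  dform (pullback phi w) t v v' = dform w (phi t) ('D_v phi t) ('D_v' phi t).
Proof.
move=> oD Dt Cphi dw; have dphi := Ck_diff Cphi Dt.
have H (u u' : 'rV[R]_m) : 'D_u (fun y => ev (pullback phi w) y u') t =
    ev w (phi t) ('D_u ('D_u' phi) t) + ev ('D_('D_u phi t) w) (phi t) ('D_u' phi t).
  have dD : is_derive t u ('D_u' phi) ('D_u ('D_u' phi) t).
    exact/derivableP/diff_derivable/(Ck_diff (Ck_D u' Cphi)).
  have dwphi : is_derive t u (fun y => w (phi y)) ('D_('D_u phi t) w (phi t)).
    rewrite -(derive_comp _ dphi dw).
    exact/derivableP/diff_derivable/(differentiable_comp dphi dw).
  have [_ E] := is_derive_dot dD dwphi.
  have {}E : 'D_u (fun y => ('D_u' phi y *m w (phi y)) 0 0 : R) t =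
      ev w (phi t) ('D_u ('D_u' phi) t) + ev ('D_('D_u phi t) w) (phi t) ('D_u' phi t).
    by rewrite E mxE.
  rewrite -E; apply: near_eq_derive.
  have [r r0 rD] := open_ball_sub oD Dt.
  apply/nbhs_ballP; exists r => // y /rD Dy.
  by rewrite ev_pullback//; exact: Ck_diff Cphi Dy.
rewrite /dform !H -/(dform w (phi t) _ _) dform_ev// (derive_commute_row v v' oD Dt Cphi).
by rewrite opprD addrACA subrr add0r.
Qed.

Lemma wedge_pullback m n (phi : 'rV[R]_m -> 'rV[R]_n) (w z : form1 R n) t v v' :
  differentiable phi t ->
  wedge (pullback phi w) (pullback phi z) t v v' =
    wedge w z (phi t) ('D_v phi t) ('D_v' phi t).
Proof. by move=> dphi; rewrite /wedge !ev_pullback. Qed.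

End Pullback.

(** * Webs on plane domains *)

Section PlaneWeb.
Context {R : realType}.

Lemma sum_i1i2 (V : nmodType) (F : 'I_2 -> V) : \sum_i F i = F i1 + F i2.
Proof.
rewrite big_ord_recl big_ord1; congr (F _ + F _); exact: val_inj.
Qed.

Definition vec2 (a b : R) : 'rV[R]_2 := \row_j (if j == i1 then a else b).

Lemma vec2_i1 a b : vec2 a b 0 i1 = a. Proof. by rewrite mxE. Qed.

Lemma vec2_i2 a b : vec2 a b 0 i2 = b. Proof. by rewrite mxE. Qed.

Lemma vec2E (v : 'rV[R]_2) : v = vec2 (v 0 i1) (v 0 i2).
Proof.
apply/rowP => j; rewrite mxE; case: eqP => [->//|].
by case: j => -[|[|//]] p H; [case: H; exact: val_inj|congr (v 0 _); exact: val_inj].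
Qed.

Notation e1 := (delta_mx 0 i1 : 'rV[R]_2).
Notation e2 := (delta_mx 0 i2 : 'rV[R]_2).

Lemma vec2_lin a b : vec2 a b = a *: e1 + b *: e2.
Proof.
rewrite [LHS]row_sum_delta sum_i1i2; congr (_ *: _ + _ *: _); by rewrite mxE.
Qed.

Lemma ev_vec2 (w : form1 R 2) t a b : ev w t (vec2 a b) = a * ev w t e1 + b * ev w t e2.
Proof. by rewrite vec2_lin evDv !evZv. Qed.

Lemma derive_vec2 (Y : normedModType R) (f : 'rV[R]_2 -> Y) t a b : differentiable f t ->
  'D_(vec2 a b) f t = a *: 'D_e1 f t + b *: 'D_e2 f t.
Proof. by move=> df; rewrite vec2_lin (deriveDv _ _ df) !(deriveZv _ _ df). Qed.

Definition web_connection (D : set 'rV[R]_2) (s1 s2 s : form1 R 2) (K : 'rV[R]_2 -> R) :=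
  [/\ [/\ open D, smooth_on D s1, smooth_on D s2 & smooth_on D s],
    (forall t v, D t -> ev s1 t v = 0 -> ev s2 t v = 0 -> v = 0),
    (forall t v v', D t -> dform s1 t v v' = wedge s1 s t v v'),
    (forall t v v', D t -> dform s2 t v v' = wedge s2 s t v v') &
    (forall t v v', D t -> dform s t v v' = K t * wedge s1 s2 t v v')].

Definition web_of_forms (s1 s2 : form1 R 2) : plane_web R := fun u t v =>
  if u == u1 then ev s1 t v = 0
  else if u == u2 then ev s2 t v = 0
  else ev s1 t v + ev s2 t v = 0.

(** If the determinant vanished, the vectors [(- q1, p1)] and [(- q2, p2)] would be killed by both
    forms, hence be zero; then all four coefficients vanish and both forms kill [e1]. *)
Lemma wedge_neq0 (s1 s2 : form1 R 2) t :
  (forall v, ev s1 t v = 0 -> ev s2 t v = 0 -> v = 0) -> wedge s1 s2 t e1 e2 != 0.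
Proof.
move=> ind; apply/eqP; rewrite /wedge.
move E1 : (ev s1 t e1) => p1; move E2 : (ev s1 t e2) => q1.
move E3 : (ev s2 t e1) => p2; move E4 : (ev s2 t e2) => q2 => W0.
have H a b : a * p1 + b * q1 = 0 -> a * p2 + b * q2 = 0 -> a = 0 /\ b = 0.
  move=> h1 h2; have : vec2 a b = 0 by apply: ind; rewrite ev_vec2 ?E1 ?E2 ?E3 ?E4.
  by move=> /rowP h; have := h i1; have := h i2; rewrite !mxE.
have [||q10 p10] := H (- q1) p1; [by ring|by rewrite -W0; ring|].
have [||q20 p20] := H (- q2) p2; [by rewrite -[RHS]oppr0 -W0; ring|by ring|].
have [||/eqP] := H 1 0; rewrite ?p10 ?p20 ?mulr0 ?mul0r ?addr0//.
by rewrite oner_eq0.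
Qed.

Lemma Ck_wedge k (D : set 'rV[R]_2) (s1 s2 : form1 R 2) v v' : open D ->
  Ck k D s1 -> Ck k D s2 -> Ck k D (fun t => wedge s1 s2 t v v' : R).
Proof.
move=> oD c1 c2; apply: Ck_add => //; first by apply: Ck_mul => //; exact: Ck_ev.
by apply: Ck_opp => //; apply: Ck_mul => //; exact: Ck_ev.
Qed.

Lemma wedge_e1e2 (s1 s2 : form1 R 2) t :
  wedge s1 s2 t e1 e2 = ev s1 t e1 * ev s2 t e2 - ev s1 t e2 * ev s2 t e1.
Proof. by []. Qed.

(* Differentiating [dX = F s1] gives [(dF - F s) /\ s1 = 0]. *)
Lemma ext_derive_proportional (N : set 'rV[R]_2) (s1 s : form1 R 2) (X F : 'rV[R]_2 -> R) t :
  open N -> N t -> Ck 2 N X -> Ck 1 N F -> Ck 1 N s1 ->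
  (forall y v, N y -> 'D_v X y = F y * ev s1 y v) ->
  dform s1 t e1 e2 = wedge s1 s t e1 e2 ->
  ('D_e1 F t - F t * ev s t e1) * ev s1 t e2 = ('D_e2 F t - F t * ev s t e2) * ev s1 t e1.
Proof.
move=> oN Nt CX CF Cs dX ds.
have H v v' : 'D_v ('D_v' X) t = F t * 'D_v (fun y => ev s1 y v') t + ev s1 t v' * 'D_v F t.
  have dF := Ck_diff CF Nt; have de := Ck_diff (Ck_ev v' oN Cs) Nt.
  rewrite -[RHS](deriveM (diff_derivable dF) (diff_derivable de)).
  apply: near_eq_derive; have [r r0 rN] := open_ball_sub oN Nt.
  by apply/nbhs_ballP; exists r => // y /rN Ny; rewrite dX.
have := derive_commute e1 e2 oN Nt CX; rewrite (H e1 e2) (H e2 e1).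
move: ds; rewrite wedge_e1e2 /dform.
move: ('D_e1 (fun _ => _) t) ('D_e2 (fun _ => _) t) ('D_e1 F t) ('D_e2 F t) => a b c d.
move: (ev _ _ _) (ev _ _ _) (ev _ _ _) (ev _ _ _) (F t) => g h k l f E1 E2.
have {}E1 : a = b + (l * k - h * g) by rewrite -E1; ring.
rewrite E1 in E2; lra.
Qed.

(* Differentiating [dF = F s] gives [F ds = 0]. *)
Lemma curvature_integrability (N : set 'rV[R]_2) (s1 s2 s : form1 R 2)
    (K F : 'rV[R]_2 -> R) t :
  open N -> N t -> Ck 2 N F -> Ck 1 N s -> F t != 0 -> wedge s1 s2 t e1 e2 != 0 ->
  (forall y, N y -> 'D_e1 F y = F y * ev s y e1 /\ 'D_e2 F y = F y * ev s y e2) ->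
  dform s t e1 e2 = K t * wedge s1 s2 t e1 e2 -> K t = 0.
Proof.
move=> oN Nt CF Cs F0 W0 dF ds.
have H v v' : (forall y, N y -> 'D_v' F y = F y * ev s y v') ->
    'D_v ('D_v' F) t = F t * 'D_v (fun y => ev s y v') t + ev s t v' * 'D_v F t.
  move=> dFv; have dFt := Ck_diff CF Nt; have de := Ck_diff (Ck_ev v' oN Cs) Nt.
  rewrite -[RHS](deriveM (diff_derivable dFt) (diff_derivable de)).
  apply: near_eq_derive; have [r r0 rN] := open_ball_sub oN Nt.
  by apply/nbhs_ballP; exists r => // y /rN Ny; rewrite dFv.
have := derive_commute e1 e2 oN Nt CF.
rewrite (H e1 e2) => [|y /dF[] //]; rewrite (H e2 e1) => [|y /dF[] //].
have [-> ->] := dF t Nt; move: ds F0 W0; rewrite /dform.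
move: ('D_e1 (fun _ => _) t) ('D_e2 (fun _ => _) t) => a b.
move: (wedge _ _ _ _ _) (ev _ _ _) (ev _ _ _) (F t) (K t) => W g h f k E F0 W0 E2.
have : f * (k * W) = 0 by rewrite -E; lra.
by move/eqP; rewrite !mulf_eq0 (negbTE F0) (negbTE W0) orbF /= => /eqP.
Qed.

(** [(u, w)] is parallel to the two independent covectors [(p1, q1)] and [(p2, q2)]. This serves
    both for [dF = F s] and for the vanishing of omega_2^1. *)
Lemma cramer0 (p1 q1 p2 q2 u w : R) : p1 * q2 - q1 * p2 != 0 ->
  u * q1 = w * p1 -> u * q2 = w * p2 -> u = 0 /\ w = 0.
Proof.
move=> d0 h1 h2; split; apply: (mulIf d0); rewrite mul0r.
  transitivity (p1 * (u * q2) - (u * q1) * p2); first by ring.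
  by rewrite h1 h2; ring.
transitivity ((w * p1) * q2 - q1 * (w * p2)); first by ring.
by rewrite -h1 -h2; ring.
Qed.

(* The covectors [x], [y], [x + y] are multiples of [(p1, q1)], [(p2, q2)] and their sum;
   the three factors coincide. *)
Lemma proportional_differentials (p1 q1 p2 q2 x1 x2 y1 y2 : R) :
  p1 * q2 - q1 * p2 != 0 ->
  - q1 * x1 + p1 * x2 = 0 -> - q2 * y1 + p2 * y2 = 0 ->
  - (q1 + q2) * x1 + (p1 + p2) * x2 + (- (q1 + q2) * y1 + (p1 + p2) * y2) = 0 ->
  let F := (x1 * q2 - x2 * p2) / (p1 * q2 - q1 * p2) in
  [/\ x1 = F * p1, x2 = F * q1, y1 = F * p2 & y2 = F * q2].
Proof.
move=> d0 h1 h2 h3 F.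
have eqd a c : a * (p1 * q2 - q1 * p2) = (x1 * q2 - x2 * p2) * c -> a = F * c.
  by move=> h; rewrite /F mulrAC -h mulfK.
have k1 : q1 * x1 = p1 * x2 by lra.
have k2 : q2 * y1 = p2 * y2 by lra.
have k3 : x1 * q2 - x2 * p2 = y2 * p1 - y1 * q1 by lra.
split; apply: eqd.
- by transitivity (x1 * p1 * q2 - (q1 * x1) * p2); [ring|rewrite k1; ring].
- by transitivity ((p1 * x2) * q2 - x2 * q1 * p2); [ring|rewrite -k1; ring].
- by rewrite k3; transitivity (p1 * (q2 * y1) - y1 * q1 * p2); [ring|rewrite k2; ring].
- by rewrite k3; transitivity (y2 * p1 * q2 - q1 * (p2 * y2)); [ring|rewrite -k2; ring].
Qed.

Lemma hexagonal_curvature0 (D : set 'rV[R]_2) (s1 s2 s : form1 R 2)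
    (K : 'rV[R]_2 -> R) (W : plane_web R) :
  web_connection D s1 s2 s K ->
  (forall t u v, D t -> W u t v <-> web_of_forms s1 s2 u t v) ->
  hexagonal D W -> forall t, D t -> K t = 0.
Proof.
move=> [[oD S1 S2 S] ind d1 d2 dK] WE hex t Dt.
have [N [N' [psi [Nt ND [oN oN' spsi _ _] Wpsi]]]] := hex t Dt.
pose X y : R := psi y 0 i1; pose Y y : R := psi y 0 i2.
have CX k : Ck k N X by exact: (Ck_mxP _ _ oN).1 (spsi k) 0 i1.
have CY k : Ck k N Y by exact: (Ck_mxP _ _ oN).1 (spsi k) 0 i2.
have C1 k : Ck k N s1 by exact: Ck_sub ND (S1 k).
have C2 k : Ck k N s2 by exact: Ck_sub ND (S2 k).
have Cs k : Ck k N s by exact: Ck_sub ND (S k).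
have W0 y : N y -> wedge s1 s2 y e1 e2 != 0.
  by move=> /ND Dy; apply: wedge_neq0 => v; exact: ind.
have key y v u : N y -> web_of_forms s1 s2 u y v <->
    (if u == u1 then 'D_v X y = 0 else if u == u2 then 'D_v Y y = 0
     else 'D_v X y + 'D_v Y y = 0).
  move=> Ny; have [WEl WEr] := WE y u v (ND _ Ny); have [Pl Pr] := Wpsi y Ny u v.
  have dpsi := Ck_diff (spsi 1) Ny.
  rewrite -!(derive_coord _ _ _ dpsi) -/(parallel_web u (psi y) ('D_v psi y)).
  by split; [move/WEr/Pl|move/Pr/WEl].
have dvec Z y a b : Ck 1 N Z -> N y ->
    'D_(vec2 a b) Z y = a * 'D_e1 Z y + b * ('D_e2 Z y : R).
  by move=> CZ Ny; rewrite derive_vec2//; exact: Ck_diff CZ Ny.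
(* The coefficient of [s1] in the expansion of [dX] in the coframe [s1], [s2], obtained as the
   quotient of [dX /\ s2] by [s1 /\ s2]. *)
pose F y := ('D_e1 X y * ev s2 y e2 - 'D_e2 X y * ev s2 y e1) / wedge s1 s2 y e1 e2.
have CF k : Ck k N F.
  apply: Ck_mul => //; last by apply: Ck_inv => //; exact: Ck_wedge.
  apply: Ck_add => //; first by apply: Ck_mul => //; [exact: Ck_D|exact: Ck_ev].
  by apply: Ck_opp => //; apply: Ck_mul => //; [exact: Ck_D|exact: Ck_ev].
have algebra y : N y ->
    [/\ 'D_e1 X y = F y * ev s1 y e1, 'D_e2 X y = F y * ev s1 y e2,
        'D_e1 Y y = F y * ev s2 y e1 & 'D_e2 Y y = F y * ev s2 y e2].
  move=> Ny; have {}W0 := W0 y Ny.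
  (* The three vectors span the kernels of [s1], [s2] and [s1 + s2]; the web property makes [X], [Y]
     and [X + Y] stationary along them. *)
  have := (key y (vec2 (- ev s1 y e2) (ev s1 y e1)) u1 Ny).1.
  have := (key y (vec2 (- ev s2 y e2) (ev s2 y e1)) u2 Ny).1.
  have := (key y (vec2 (- (ev s1 y e2 + ev s2 y e2)) (ev s1 y e1 + ev s2 y e1)) u3 Ny).1.
  rewrite /web_of_forms /= !dvec ?ev_vec2// /F.
  move: W0; rewrite wedge_e1e2.
  move: ('D_e1 X y) ('D_e2 X y) ('D_e1 Y y) ('D_e2 Y y) => x1 x2 y1 y2.
  move: (ev s1 y e1) (ev s1 y e2) (ev s2 y e1) (ev s2 y e2) => p1 q1 p2 q2 W0 h3 h2 h1.
  by apply: proportional_differentials W0 (h1 _) (h2 _) (h3 _); ring.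
have dX y v : N y -> 'D_v X y = F y * ev s1 y v.
  move=> Ny; have [h1 h2 _ _] := algebra y Ny.
  rewrite [v]vec2E dvec// ev_vec2 h1 h2; ring.
have dY y v : N y -> 'D_v Y y = F y * ev s2 y v.
  move=> Ny; have [_ _ h1 h2] := algebra y Ny.
  rewrite [v]vec2E dvec// ev_vec2 h1 h2; ring.
(* [dF - F s] is proportional to both [s1] and [s2], hence zero. *)
have dF y : N y -> 'D_e1 F y = F y * ev s y e1 /\ 'D_e2 F y = F y * ev s y e2.
  move=> Ny; have {}W0 := W0 y Ny; have Dy := ND _ Ny.
  have := ext_derive_proportional oN Ny (CX 2) (CF 1) (C1 1) dX (d1 y e1 e2 Dy).
  have := ext_derive_proportional oN Ny (CY 2) (CF 1) (C2 1) dY (d2 y e1 e2 Dy).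
  move: W0; rewrite wedge_e1e2.
  move: ('D_e1 F y) ('D_e2 F y) => f1 f2.
  move: (ev s1 y e1) (ev s1 y e2) (ev s2 y e1) (ev s2 y e2) => p1 q1 p2 q2.
  move: (ev s y e1) (ev s y e2) (F y) => g h f W0 E2 E1.
  by have [u0 w0] := cramer0 W0 E1 E2; split; apply/eqP; rewrite -subr_eq0; apply/eqP.
(* If [F t] vanished, so would [dX] at [t]; every vector would then be tangent to the first family,
   and [s1] would vanish at [t]. *)
have F0 : F t != 0.
  apply/eqP => Ft0; have h1 := (key t e1 u1 Nt).2; have h2 := (key t e2 u1 Nt).2.
  rewrite /web_of_forms/= !dX ?Ft0 ?mul0r// in h1 h2.
  by have := W0 t Nt; rewrite wedge_e1e2 h1// h2// !mul0r subrr eqxx.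
exact: (curvature_integrability oN Nt (CF 2) (Cs 1) F0 (W0 _ Nt) dF (dK t e1 e2 Dt)).
Qed.

Lemma differentiable_expR (y : R) : differentiable (expR : R -> R) y.
Proof. exact/derivable1_diffP/derivable_expR. Qed.

Lemma derive_expRv (y d : R) : 'D_d (expR : R -> R) y = expR y * d.
Proof.
have : 'D_(d *: (1 : R)) (expR : R -> R) y = d *: 'D_1 (expR : R -> R) y.
  exact: deriveZv (differentiable_expR y).
by rewrite [d *: 1]mulr1 => ->; rewrite derive_val mulrC.
Qed.

Lemma Ck_expR (X : normedModType R) k (U : set X) (f : X -> R) : open U ->
  Ck k U f -> Ck k U (fun x => expR (f x) : R).
Proof.
move=> oU; elim: k => [|k IH] Cf.
  move=> x Ux; apply: (continuous_comp (Ck_continuous Cf Ux)); exact: continuous_expR.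
have de := differentiable_expR.
split=> [x Ux|v].
  exact: (differentiable_comp (Ck_diff Cf Ux) (de _)).
apply: (@Ck_eq _ _ _ _ _ (fun x => expR (f x) * 'D_v f x)) => // [x Ux|].
  by rewrite (derive_comp v (Ck_diff Cf Ux) (de _)) derive_expRv.
by apply: Ck_mul => //; [exact/IH/CkW|exact: Ck_D].
Qed.

Lemma curvature0_hexagonal (D : set 'rV[R]_2) (s1 s2 s : form1 R 2)
    (K : 'rV[R]_2 -> R) (W : plane_web R) :
  web_connection D s1 s2 s K ->
  (forall t u v, D t -> W u t v <-> web_of_forms s1 s2 u t v) ->
  (forall t, D t -> K t = 0) -> hexagonal D W.
Proof.
move=> [[oD S1 S2 S] ind d1 d2 dK] WE K0 t Dt.
have ds0 y v v' : D y -> dform s y v v' = 0 by move=> Dy; rewrite dK// K0// mul0r.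
have [r [g [r0 rD Sg dg]]] := smooth_closed_form_primitive oD Dt S ds0.
pose B := ball t r; have oB : open B by exact: ball_open.
have Bt : B t by exact: ballxx.
(* Integrating factor: for [s'] equal to [s1] or [s2], the term [dF /\ s' = F s /\ s'] cancels
   [F ds' = F s' /\ s] in [d(F s')]. *)
pose F y := expR (g y).
have CF k : Ck k B F by exact: Ck_expR.
have dF y v : B y -> 'D_v F y = F y * ev s y v.
  move=> By; rewrite (derive_comp v (Ck_diff (Sg 1) By) (differentiable_expR _)).
  by rewrite derive_expRv dg.
have prim (s' : form1 R 2) : smooth_on D s' ->
    (forall y v v', D y -> dform s' y v v' = wedge s' s y v v') ->
    exists r' X, [/\ 0 < r', ball t r' `<=` B, smooth_on (ball t r') (X : _ -> R) &
      forall x v, ball t r' x -> 'D_v X x = F x * ev s' x v].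
  move=> S' d'.
  pose w : form1 R 2 := fun y => F y *: s' y.
  have evw y v : ev w y v = F y * ev s' y v by rewrite /ev /w -scalemxAr mxE.
  have Sw : smooth_on B w.
    move=> k; apply: Ck_form => // i.
    apply: (@Ck_eq _ _ _ _ _ (fun y => F y * s' y i 0)) => // [y _|].
      by rewrite mxE.
    apply: Ck_mul => //; apply: Ck_coord => //; exact: Ck_sub rD (S' k).
  have dw0 y v v' : B y -> dform w y v v' = 0.
    move=> By; have Dy := rD _ By.
    have H u u' : 'D_u (fun y => ev w y u') y =
        F y * 'D_u (fun y => ev s' y u') y + ev s' y u' * 'D_u F y.
      have dFy := Ck_diff (CF 1) By; have de := Ck_diff (Ck_ev u' oD (S' 1)) Dy.
      rewrite -[RHS](deriveM (diff_derivable dFy) (diff_derivable de)).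
      apply: near_eq_derive; have [r' r'0 r'N] := open_ball_sub oB By.
      by apply/nbhs_ballP; exists r' => // z _; rewrite evw.
    move: (d' y v v' Dy); rewrite /dform (H v v') (H v' v) !dF// /wedge.
    move: ('D_v (fun _ => _) y) ('D_v' (fun _ => _) y) => a b E.
    have {}E : a = b + (ev s' y v * ev s y v' - ev s' y v' * ev s y v) by rewrite -E; ring.
    rewrite E; ring.
  have [r' [X [r'0 r'B SX dX]]] := smooth_closed_form_primitive oB Bt Sw dw0.
  by exists r', X; split => // x v Bx; rewrite dX.
have [r1 [X [r10 r1B SX dX]]] := prim s1 S1 d1.
have [r2 [Y [r20 r2B SY dY]]] := prim s2 S2 d2.
pose B' := ball t (Num.min r1 r2).
have oB' : open B' by exact: ball_open.
have B1 : B' `<=` ball t r1 by apply: le_ball; rewrite ge_min lexx.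
have B2 : B' `<=` ball t r2 by apply: le_ball; rewrite ge_min lexx orbT.
have B't : B' t by apply: ballxx; rewrite lt_min r10.
pose psi y := vec2 (X y) (Y y).
have Spsi : smooth_on B' psi.
  move=> k; apply/(Ck_mxP _ _ oB') => i j.
  case: (eqVneq j i1) => [->|j1].
    apply: (@Ck_eq _ _ _ _ _ X) => // [y _|]; last exact: Ck_sub B1 (SX k).
    by rewrite (ord1 i) vec2_i1.
  apply: (@Ck_eq _ _ _ _ _ Y) => // [y _|]; last exact: Ck_sub B2 (SY k).
  by rewrite mxE (negbTE j1).
have F0 y : F y != 0 by rewrite gt_eqF// expR_gt0.
have dpsi y v : B' y -> 'D_v psi y = vec2 (F y * ev s1 y v) (F y * ev s2 y v).
  move=> By; apply/rowP => j; rewrite (derive_coord _ _ _ (Ck_diff (Spsi 1) By)).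
  rewrite mxE; case: (eqVneq j i1) => [->|j1].
    rewrite -dX; last exact: B1.
    by congr ('D_v _ y); apply/funext => z; rewrite vec2_i1.
  rewrite -dY; last exact: B2.
  by congr ('D_v _ y); apply/funext => z; rewrite mxE (negbTE j1).
have psi_inj x v : B' x -> 'D_v psi x = 0 -> v = 0.
  move=> Bx; rewrite dpsi// => /rowP h; have := h i1; have := h i2.
  rewrite !mxE /= => /eqP h2 /eqP h1; apply: (ind x); first exact/rD/r1B/B1.
    by move: h1; rewrite mulf_eq0 (negbTE (F0 x)) => /eqP.
  by move: h2; rewrite mulf_eq0 (negbTE (F0 x)) => /eqP.
have [N [N' [chi [[oN oN' Nt NB] [Schi NN' N'N can1 can2]]]]] :=
  inverse_function oB' B't Spsi psi_inj.
have ND x : N x -> D x by move=> /NB/B1/r1B/rD.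
exists N, N', psi; split=> //.
  by split=> //; [move=> k; exact: Ck_sub NB (Spsi k)|exists chi].
move=> y Ny u v; have [h1 h2] := WE y u v (ND _ Ny).
suff : web_of_forms s1 s2 u y v <-> parallel_web u (psi y) ('D_v psi y).
  by move=> [h3 h4]; split; [move/h1/h3|move/h4/h2].
have mulF0 (a : R) : F y * a = 0 <-> a = 0.
  split=> [/eqP|->]; last by rewrite mulr0.
  by rewrite mulf_eq0 (negbTE (F0 y)) => /eqP.
rewrite dpsi; last exact: NB.
(* Since [dX] and [dY] carry the same nonzero factor [F], the line [s1 + s2 = 0] is also the line
   [dX + dY = 0]. *)
rewrite /web_of_forms /parallel_web vec2_i1 vec2_i2 -mulrDr.
by case: ifP => _; [|case: ifP => _]; apply: iff_sym.
Qed.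

End PlaneWeb.

(** * Changes of frame *)

Section FrameChange.
Context {R : realType}.
Implicit Types (A B : 'M[R]_2).

(* [w, th, ph, dA] and [w', th', ph', dA'] are the values, at two tangent vectors, of
   the coframe, of the connections in the old and in the new frame, and of the
   differential of the change of frame [A]. *)
Lemma frame_change_torsion A (dA dA' th th' ph ph' : 'I_2 -> 'I_2 -> R)
    (w w' a a' : 'I_2 -> R) (eps : R) i :
  let W j := \sum_k A j k * w k in
  let W' j := \sum_k A j k * w' k in
  let tau m := \sum_j A j m * ph j i + dA i m - \sum_k A i k * th m k in
  let tau' m := \sum_j A j m * ph' j i + dA' i m - \sum_k A i k * th' m k in
  \sum_j (W j * ph' j i - W' j * ph j i) +
    eps * \sum_j a' j * (W j * W' i - W' j * W i) -
  \sum_k (dA i k * w' k - dA' i k * w k + A i k *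
    (\sum_j (w j * th' j k - w' j * th j k) +
     eps * \sum_j a j * (w j * w' k - w' j * w k))) =
  \sum_m (w m * tau' m - w' m * tau m) +
    eps * \sum_j (\sum_m a' m * A m j - a j) * (w j * W' i - w' j * W i).
Proof. by rewrite /= !sum_i1i2; ring. Qed.

(** The first two hypotheses are the gauge relation for [dA] at the two tangent vectors; the third
    is its exterior derivative, that is [d(dA) = 0]. Substituting the former into the latter cancels
    the inhomogeneous terms. *)
Lemma frame_change_curvature A (dA dA' th th' ph ph' dth dph : 'I_2 -> 'I_2 -> R) i m :
  (forall i m, dA i m = \sum_k A i k * th m k - \sum_j A j m * ph j i) ->
  (forall i m, dA' i m = \sum_k A i k * th' m k - \sum_j A j m * ph' j i) ->
  \sum_j (dA j m * ph' j i - dA' j m * ph j i + A j m * dph j i) =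
  \sum_k (dA i k * th' m k - dA' i k * th m k + A i k * dth m k) ->
  \sum_j A j m * (dph j i - \sum_k (ph j k * ph' k i - ph' j k * ph k i)) =
  \sum_k A i k * (dth m k - \sum_l (th m l * th' l k - th' m l * th l k)).
Proof.
move=> E E'; rewrite !sum_i1i2 !E !E' !sum_i1i2 => H.
apply/eqP; rewrite -subr_eq0; move/eqP: H; rewrite -subr_eq0 => /eqP <-; apply/eqP; ring.
Qed.

(** When [a = a' A] is differentiated and the gauge relation inserted, the terms in [th] recombine
    into [a], so the covariant derivative obeys the same law as the covector. *)
Lemma frame_change_covector A (dA th ph : 'I_2 -> 'I_2 -> R) (da a da' a' : 'I_2 -> R) m :
  (forall i m, dA i m = \sum_k A i k * th m k - \sum_j A j m * ph j i) ->
  (forall m, a m = \sum_j a' j * A j m) ->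
  da m = \sum_j (da' j * A j m + a' j * dA j m) ->
  \sum_j A j m * (da' j - \sum_i a' i * ph j i) = da m - \sum_k a k * th m k.
Proof.
move=> E Ea ->; rewrite !sum_i1i2 !E !Ea !sum_i1i2; ring.
Qed.

Lemma frame_change_alt1 A B (b : 'I_2 -> 'I_2 -> 'I_2 -> 'I_2 -> R) (p : 'I_2 -> 'I_2 -> R) :
  (forall i k, \sum_s A i s * B s k = delta R i k) ->
  (forall i j k l, alt (fun j' k' => b i j' l k') j k =
     alt (fun k' j' => delta R i k' * p j' l) k j) ->
  let b' i j k l := \sum_q \sum_r \sum_s \sum_u A i q * B r j * B s k * B u l * b q r s u in
  let p' i j := \sum_k \sum_l B k i * B l j * p k l in
  forall i j k l, alt (fun j' k' => b' i j' l k') j k =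
     alt (fun k' j' => delta R i k' * p' j' l) k j.
Proof.
move=> AB H b' p' i j k l.
(* With two index values an alternation has a single component, so the hypothesis amounts to these
   relations, solved for one curvature entry. *)
have {}H q s : b q i1 s i2 = b q i2 s i1 + delta R q i2 * p i1 s - delta R q i1 * p i2 s.
  have := H q i1 i2 s; rewrite /alt => /(mulIf (_ : 2^-1 != 0)) => /(_ _) h.
  by apply/eqP; rewrite -addrA addrC -subr_eq h//; rewrite invr_eq0 pnatr_eq0.
(* Undoing [A B = 1] turns the deltas of the new frame into products of entries, so that both sides
   become polynomials. *)
rewrite /alt; congr (_ / 2); rewrite /b' /p' -!AB !sum_i1i2 !H /delta /=.
ring.
Qed.

Lemma frame_change_alt2 A B (b : 'I_2 -> 'I_2 -> 'I_2 -> 'I_2 -> R) (p : 'I_2 -> 'I_2 -> R) :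
  (forall i k, \sum_s A i s * B s k = delta R i k) ->
  (forall i j k l, alt (fun j' k' => b i j' k' l) j k =
     alt (fun k' j' => delta R i k' * p j' l) k j) ->
  let b' i j k l := \sum_q \sum_r \sum_s \sum_u A i q * B r j * B s k * B u l * b q r s u in
  let p' i j := \sum_k \sum_l B k i * B l j * p k l in
  forall i j k l, alt (fun j' k' => b' i j' k' l) j k =
     alt (fun k' j' => delta R i k' * p' j' l) k j.
Proof.
move=> AB H b' p' i j k l.
have {}H q s : b q i1 i2 s = b q i2 i1 s + delta R q i2 * p i1 s - delta R q i1 * p i2 s.
  have := H q i1 i2 s; rewrite /alt => /(mulIf (_ : 2^-1 != 0)) => /(_ _) h.
  by apply/eqP; rewrite -addrA addrC -subr_eq h//; rewrite invr_eq0 pnatr_eq0.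
rewrite /alt; congr (_ / 2); rewrite /b' /p' -!AB !sum_i1i2 !H /delta /=.
ring.
Qed.

End FrameChange.

(** * Exterior derivatives of linear combinations and of exact forms *)

Section ExteriorCalculus.
Context {R : realType}.

Lemma dform_eq n (w w' : form1 R n) (U : set 'rV[R]_n) x v v' : open U -> U x ->
  (forall y, U y -> w y = w' y) -> dform w x v v' = dform w' x v v'.
Proof.
move=> oU Ux E; have [r r0 rU] := open_ball_sub oU Ux.
by rewrite /dform; congr (_ - _); apply: near_eq_derive; apply/nbhs_ballP;
  exists r => // y /rU Uy; rewrite /ev E.
Qed.

Lemma dform0 n (w : form1 R n) (U : set 'rV[R]_n) x v v' : open U -> U x ->
  (forall y u, U y -> ev w y u = 0) -> dform w x v v' = 0.
Proof.
move=> oU Ux E; have [r r0 rU] := open_ball_sub oU Ux.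
have H u u' : 'D_u (fun y => ev w y u') x = 0.
  rewrite -[RHS](derive_cst (0 : R) x u); apply: near_eq_derive.
  by apply/nbhs_ballP; exists r => // y /rU Uy; rewrite E.
by rewrite /dform (H v v') (H v' v) subrr.
Qed.

Lemma ev_sum n (I : finType) (f : I -> 'rV[R]_n -> R) (w : I -> form1 R n) x v :
  ev (fun y => \sum_k f k y *: w k y) x v = \sum_k f k x * ev (w k) x v.
Proof.
rewrite /ev mulmx_sumr summxE; apply: eq_bigr => k _.
by rewrite -scalemxAr mxE.
Qed.

Lemma form_ext n (w w' : form1 R n) y : (forall u, ev w y u = ev w' y u) -> w y = w' y.
Proof. by move=> H; apply/colP => p; rewrite -!ev_delta. Qed.

Lemma evB n (w z : form1 R n) x v : ev (fun y => w y - z y) x v = ev w x v - ev z x v.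
Proof. by rewrite /ev mulmxBr !mxE. Qed.

Lemma dform_lincomb n m (f : 'I_m -> 'rV[R]_n -> R) (w : 'I_m -> form1 R n) x v v' :
  (forall k, differentiable (f k) x) -> (forall k, differentiable (w k) x) ->
  dform (fun y => \sum_k f k y *: w k y) x v v' =
  \sum_k ('D_v (f k) x * ev (w k) x v' - 'D_v' (f k) x * ev (w k) x v +
           f k x * dform (w k) x v v').
Proof.
move=> df dw.
have H u u' : 'D_u (fun y => ev (fun y => \sum_k f k y *: w k y) y u') x =
    \sum_k (f k x * 'D_u (fun y => ev (w k) y u') x + ev (w k) x u' * 'D_u (f k) x).
  have -> : (fun y => ev (fun y => \sum_k f k y *: w k y) y u') =
      \sum_k ((f k : _ -> R) * (fun y => ev (w k) y u')).
    by apply/funext => y; rewrite ev_sum fct_sumE.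
  have hk k : is_derive x u ((f k : _ -> R) * (fun y => ev (w k) y u'))
      (f k x * 'D_u (fun y => ev (w k) y u') x + ev (w k) x u' * 'D_u (f k) x).
    apply: is_deriveM; first exact/derivableP/diff_derivable.
    by apply/derivableP; have [] := derive_ev u u' (dw k).
  by have [_ ->] := is_derive_sum hk.
rewrite {1}/dform (H v v') (H v' v) -sumrB; apply: eq_bigr => k _; rewrite /dform; ring.
Qed.

Lemma dformB n (w z : form1 R n) x v v' : differentiable w x -> differentiable z x ->
  dform (fun y => w y - z y) x v v' = dform w x v v' - dform z x v v'.
Proof.
move=> dw dz.
have H u u' : 'D_u (fun y => ev (fun y => w y - z y) y u') x =
    'D_u (fun y => ev w y u') x - 'D_u (fun y => ev z y u') x.
  have [h1 _] := derive_ev u u' dw; have [h2 _] := derive_ev u u' dz.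
  rewrite -deriveB//; congr ('D_u _ x).
  by apply/funext => y; rewrite evB.
rewrite /dform (H v v') (H v' v); ring.
Qed.

Definition exact_form n (f : 'rV[R]_n -> R) : form1 R n :=
  fun x => \col_i 'D_(delta_mx 0 i) f x.

Lemma ev_exact n (f : 'rV[R]_n -> R) x v : differentiable f x ->
  ev (exact_form f) x v = 'D_v f x.
Proof.
by move=> df; rewrite (derive_row _ df) evE; apply: eq_bigr => i _; rewrite mxE.
Qed.

Lemma smooth_exact n (f : 'rV[R]_n -> R) (U : set 'rV[R]_n) : open U ->
  smooth_on U (f : _ -> R) -> smooth_on U (exact_form f).
Proof.
move=> oU sf k; apply: Ck_form => // i.
apply: (@Ck_eq _ _ _ _ _ ('D_(delta_mx 0 i) f)) => // [x _|]; first by rewrite mxE.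
exact: Ck_D (sf k.+1).
Qed.

Lemma dform_exact n (f : 'rV[R]_n -> R) (U : set 'rV[R]_n) x v v' : open U -> U x ->
  Ck 2 U f -> dform (exact_form f) x v v' = 0.
Proof.
move=> oU Ux Cf; have [r r0 rU] := open_ball_sub oU Ux.
have H u u' : 'D_u (fun y => ev (exact_form f) y u') x = 'D_u ('D_u' f) x.
  apply: near_eq_derive; apply/nbhs_ballP; exists r => // y /rU Uy.
  by rewrite ev_exact//; exact: Ck_diff Cf Uy.
by rewrite /dform (H v v') (H v' v) (derive_commute v v' oU Ux Cf) subrr.
Qed.

Lemma smooth_lincomb n m (f : 'I_m -> 'rV[R]_n -> R) (w : 'I_m -> form1 R n)
    (U : set 'rV[R]_n) : open U -> (forall k, smooth_on U (f k : _ -> R)) ->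
  (forall k, smooth_on U (w k)) -> smooth_on U (fun y => \sum_k f k y *: w k y).
Proof.
move=> oU sf sw k; apply: Ck_form => // i.
apply: (@Ck_eq _ _ _ _ _ (fun y => \sum_j f j y * w j y i 0)) => // [y _|].
  by rewrite summxE; apply: eq_bigr => j _; rewrite mxE.
by apply: Ck_sum => // j; apply: Ck_mul => //; [exact: sf|exact: (Ck_coord i oU (sw j k))].
Qed.

End ExteriorCalculus.

(** * Web forms and torsion under a change of frame *)

Section WebFrames.
Context {R : realType}.

Lemma invmx_sumr (A : 'M[R]_2) i k : A \in unitmx -> \sum_s A i s * invmx A s k = delta R i k.
Proof. by move=> /mulmxV /matrixP /(_ i k); rewrite !mxE. Qed.

Lemma invmx_suml (A : 'M[R]_2) i k : A \in unitmx -> \sum_s invmx A i s * A s k = delta R i k.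
Proof. by move=> /mulVmx /matrixP /(_ i k); rewrite !mxE. Qed.

Lemma sum_delta (F : 'I_2 -> R) k : \sum_i delta R k i * F i = F k.
Proof.
rewrite (bigD1 k)//= /delta eqxx mul1r big1 ?addr0// => i ik.
by rewrite eq_sym (negbTE ik) mul0r.
Qed.

Lemma solve_frame (A : 'M[R]_2) (X Y : 'I_2 -> R) : A \in unitmx ->
  (forall m, \sum_j A j m * X j = Y m) -> forall j, X j = \sum_m invmx A m j * Y m.
Proof.
move=> uA H j.
transitivity (\sum_m invmx A m j * \sum_l A l m * X l); last first.
  by apply: eq_bigr => m _; rewrite H.
transitivity (\sum_l delta R l j * X l).
  by rewrite -[LHS](sum_delta X); apply: eq_bigr => l _; rewrite /delta eq_sym.
under eq_bigr => l _ do rewrite -(invmx_sumr l j uA) mulr_suml.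
rewrite exchange_big/=; apply: eq_bigr => m _; rewrite mulr_sumr.
by apply: eq_bigr => l _; rewrite mulrA [A l m * _]mulrC.
Qed.

Section Change.
Context (V : set 'rV[R]_4) (omega omega' : web_forms R) (A : 'rV[R]_4 -> 'M[R]_2).
Context (oV : open V) (somega : forall u i, smooth_on V (omega u i)).
Context (sA : smooth_on V A) (uA : forall x, V x -> A x \in unitmx).
Context (omegaE : forall x, V x -> forall u i, omega' u i x = \sum_j A x i j *: omega u j x).

Lemma smooth_entry i j : smooth_on V (fun x => A x i j : R).
Proof. by move=> k; exact: (Ck_mxP _ _ oV).1 (sA k) i j. Qed.

Lemma differentiable_entry i j x : V x -> differentiable (fun x => A x i j : R) x.
Proof. by move=> Vx; exact: Ck_diff (smooth_entry i j 1) Vx. Qed.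

Lemma smooth_invmx i j : smooth_on V (fun x => invmx (A x) i j : R).
Proof. by move=> k; apply: Ck_invmx => // i' j'; exact: smooth_entry. Qed.

Lemma smooth_omega' u i : smooth_on V (omega' u i).
Proof.
move=> k; apply: (@Ck_eq _ _ _ _ _ (fun x => \sum_j A x i j *: omega u j x)) => //.
  by move=> x Vx; rewrite omegaE.
by apply: smooth_lincomb => // j; exact: smooth_entry.
Qed.

Lemma ev_omega' u i x v : V x -> ev (omega' u i) x v = \sum_j A x i j * ev (omega u j) x v.
Proof.
move=> Vx; rewrite -(ev_sum (fun j y => A y i j) (omega u)).
by rewrite /ev omegaE.
Qed.

Lemma dform_omega' u i x v v' : V x -> dform (omega' u i) x v v' =
  \sum_k ('D_v (fun y => A y i k : R) x * ev (omega u k) x v' -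
          'D_v' (fun y => A y i k : R) x * ev (omega u k) x v +
          A x i k * dform (omega u k) x v v').
Proof.
move=> Vx; rewrite (dform_eq v v' oV Vx (fun y Vy => omegaE Vy u i)).
rewrite dform_lincomb// => k; first exact: differentiable_entry.
exact: Ck_diff (somega u k 1) Vx.
Qed.

(** [eps] is 1 for the first foliation and -1 for the second. [tau] measures how far [ph] is from
    the transformed connection, the last sum how far [a'] is from the transformed covector. If the
    left-hand side is zero, this gives uniqueness of the covector; if both defects are zero, it
    gives the structure equations of the new frame. *)
Lemma torsion_identity (S : web_structure R) (ph : 'I_2 -> 'I_2 -> form1 R 4)
    (a' : 'I_2 -> R) (u : 'I_3) (eps : R) x v v' i : V x ->
  (forall k, dform (omega u k) x v v' = \sum_j wedge (omega u j) (conn S j k) x v v' +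
     eps * \sum_j cov S j x * wedge (omega u j) (omega u k) x v v') ->
  let tau y m := \sum_j A x j m * ev (ph j i) x y + 'D_y (fun z => A z i m : R) x -
    \sum_k A x i k * ev (conn S m k) x y in
  \sum_j wedge (omega' u j) (ph j i) x v v' +
     eps * \sum_j a' j * wedge (omega' u j) (omega' u i) x v v' -
     dform (omega' u i) x v v' =
  \sum_m (ev (omega u m) x v * tau v' m - ev (omega u m) x v' * tau v m) +
  eps * \sum_j (\sum_m a' m * A x m j - cov S j x) *
    (ev (omega u j) x v * ev (omega' u i) x v' - ev (omega u j) x v' * ev (omega' u i) x v).
Proof.
move=> Vx st tau.
rewrite (dform_omega' _ _ _ _ Vx) /wedge.
under eq_bigr => k _ do rewrite !(ev_omega' _ _ _ Vx).
under [X in eps * X]eq_bigr => k _ do rewrite !(ev_omega' _ _ _ Vx).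
under [X in _ - X]eq_bigr => k _ do rewrite st.
under [X in _ = _ + eps * X]eq_bigr => k _ do rewrite !(ev_omega' _ _ _ Vx).
exact: (frame_change_torsion (A x) (fun i k => 'D_v (fun y => A y i k : R) x)
  (fun i k => 'D_v' (fun y => A y i k : R) x)
  (fun m k => ev (conn S m k) x v) (fun m k => ev (conn S m k) x v')
  (fun j i => ev (ph j i) x v) (fun j i => ev (ph j i) x v')
  (fun j => ev (omega u j) x v) (fun j => ev (omega u j) x v')
  (fun j => cov S j x) a' eps i).
Qed.

End Change.
End WebFrames.

(** * The coframe of the web and uniqueness of the covector *)

Section CovectorChange.
Context {R : realType}.

(** Transversality of the first two foliations is the linear independence of the four columns of
    [M]. *)
Lemma web_coframe_matrix (U : set 'rV[R]_4) (omega : web_forms R) x :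
  is_web322 U omega -> U x -> exists2 M : 'M[R]_(4, 2 + 2), (M : 'M[R]_4) \in unitmx &
  forall v : 'rV[R]_4, v *m M =
    row_mx (\row_i ev (omega u1 i) x v) (\row_i ev (omega u2 i) x v).
Proof.
move=> [_ _ tr _] Ux; have {}tr := tr x u1 u2 Ux isT.
pose M1 : 'M[R]_(4, 2) := \matrix_(m, i) omega u1 i x m 0.
pose M2 : 'M[R]_(4, 2) := \matrix_(m, i) omega u2 i x m 0.
exists (row_mx M1 M2) => [|v]; last first.
  rewrite mul_mx_row; congr row_mx; apply/rowP => i; rewrite !mxE /ev mxE;
  by apply: eq_bigr => j _; rewrite mxE.
rewrite -unitmx_tr -row_free_unit -kermx_eq0; apply/rowV0P => r /sub_kermxP rM.
pose r1 : 'rV[R]_2 := lsubmx (r : 'rV_(2 + 2)); pose r2 : 'rV[R]_2 := rsubmx (r : 'rV_(2 + 2)).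
have rE : r = row_mx r1 r2 by rewrite hsubmxK.
have H : \sum_i r1 0 i *: omega u1 i x + \sum_i r2 0 i *: omega u2 i x = 0.
  apply/colP => m; rewrite [RHS]mxE; move: rM; rewrite rE (tr_row_mx M1 M2).
  rewrite (mul_row_col r1 r2) => /rowP/(_ m); rewrite !mxE => <-.
  by rewrite !summxE; congr (_ + _); apply: eq_bigr => i _; rewrite !mxE.
have r0 := tr _ _ H.
have z1 : r1 = 0 by apply/rowP => i; rewrite (r0 i).1 mxE.
have z2 : r2 = 0 by apply/rowP => i; rewrite (r0 i).2 mxE.
by rewrite rE z1 z2 row_mx0.
Qed.

Lemma web_coframe_dual (U : set 'rV[R]_4) (omega : web_forms R) x (c d : 'I_2 -> R) :
  is_web322 U omega -> U x -> exists v, forall i,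
    ev (omega u1 i) x v = c i /\ ev (omega u2 i) x v = d i.
Proof.
move=> web Ux; have [M uM ME] := web_coframe_matrix web Ux.
pose w : 'rV[R]_4 := row_mx (\row_i c i) (\row_i d i).
exists (w *m invmx (M : 'M[R]_4)) => i.
have : w *m invmx (M : 'M[R]_4) *m M = w by rewrite mulmxKV.
rewrite ME => /eq_row_mx[/rowP/(_ i) h1 /rowP/(_ i) h2].
by move: h1 h2; rewrite !mxE.
Qed.

Lemma web_coframe (U : set 'rV[R]_4) (omega : web_forms R) x v :
  is_web322 U omega -> U x -> (forall i, ev (omega u1 i) x v = 0) ->
  (forall i, ev (omega u2 i) x v = 0) -> v = 0.
Proof.
move=> web Ux h1 h2; have [M uM ME] := web_coframe_matrix web Ux.
rewrite -[v](mulmxK uM) [v *m _]ME.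
rewrite (_ : row_mx _ _ = 0) ?mul0mx//.
rewrite -[RHS](@row_mx0 _ 1 2 2); congr row_mx; apply/rowP => i; by rewrite !mxE.
Qed.

(** On the dual vectors [E2 m], [E1 n], the identity of the second foliation gives [tau = 0] on
    [E1 n]. On [E1 i1], [E1 i2], that of the first foliation then says that the invertible matrix
    [A x] kills the column [(- c i2, c i1)], so the defect [c] of the covector vanishes. *)
Lemma cov_change (U V : set 'rV[R]_4) (omega omega' : web_forms R) (A : 'rV[R]_4 -> 'M[R]_2)
    (S S' : web_structure R) :
  open V -> V `<=` U -> is_web322 U omega -> structure_equations U omega S ->
  smooth_on V A -> (forall x, V x -> A x \in unitmx) ->
  (forall x, V x -> forall u i, omega' u i x = \sum_j A x i j *: omega u j x) ->
  structure_equations V omega' S' ->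
  forall x, V x -> forall j, cov S j x = \sum_m cov S' m x * A x m j.
Proof.
move=> oV VU web st sA uA E st' x Vx j.
have Ux := VU _ Vx; have [sw _ _ _] := web.
have somega u i : smooth_on V (omega u i) by move=> k; exact: Ck_sub VU (sw u i k).
have [_ e1 _ _ _] := st; have [_ e1' _ _ _] := st'.
pose tau i (y : 'rV[R]_4) m := \sum_j A x j m * ev (conn S' j i) x y +
  'D_y (fun z => A z i m : R) x - \sum_k A x i k * ev (conn S m k) x y.
pose c j := \sum_m cov S' m x * A x m j - cov S j x.
have T u eps i v v' :
  (forall k, dform (omega u k) x v v' = \sum_j wedge (omega u j) (conn S j k) x v v' +
     eps * \sum_j cov S j x * wedge (omega u j) (omega u k) x v v') ->
  (forall k, dform (omega' u k) x v v' = \sum_j wedge (omega' u j) (conn S' j k) x v v' +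
     eps * \sum_j cov S' j x * wedge (omega' u j) (omega' u k) x v v') ->
  \sum_m (ev (omega u m) x v * tau i v' m - ev (omega u m) x v' * tau i v m) +
  eps * \sum_j c j * (ev (omega u j) x v * ev (omega' u i) x v' -
    ev (omega u j) x v' * ev (omega' u i) x v) = 0.
  move=> h1 h2.
  rewrite -(torsion_identity oV somega sA E (S := S) (conn S') (fun m => cov S' m x) i Vx h1).
  by rewrite h2 subrr.
have T1 i v v' : \sum_m (ev (omega u1 m) x v * tau i v' m - ev (omega u1 m) x v' * tau i v m) +
  1 * \sum_j c j * (ev (omega u1 j) x v * ev (omega' u1 i) x v' -
    ev (omega u1 j) x v' * ev (omega' u1 i) x v) = 0.
  apply: T => k; rewrite mul1r; first exact: (e1 x Ux k v v').1.
  exact: (e1' x Vx k v v').1.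
have T2 i v v' : \sum_m (ev (omega u2 m) x v * tau i v' m - ev (omega u2 m) x v' * tau i v m) +
  -1 * \sum_j c j * (ev (omega u2 j) x v * ev (omega' u2 i) x v' -
    ev (omega u2 j) x v' * ev (omega' u2 i) x v) = 0.
  apply: T => k; rewrite mulN1r; first exact: (e1 x Ux k v v').2.
  exact: (e1' x Vx k v v').2.
have [E1 HE1] := choice (fun m => web_coframe_dual (delta R m) (fun=> 0) web Ux).
have [E2 HE2] := choice (fun m => web_coframe_dual (fun=> 0) (delta R m) web Ux).
have wE1 i n : ev (omega' u1 i) x (E1 n) = A x i n.
  rewrite (ev_omega' E)// -[RHS](sum_delta (A x i)).
  by apply: eq_bigr => k _; rewrite (HE1 n k).1 mulrC.
have wE2 i n : ev (omega' u2 i) x (E1 n) = 0.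
  by rewrite (ev_omega' E)// big1// => k _; rewrite (HE1 n k).2 mulr0.
have t1 i n m : tau i (E1 n) m = 0.
  move: (T2 i (E2 m) (E1 n)); rewrite !sum_i1i2 !(HE1 n _).2 !(HE2 m _).2 wE2.
  by rewrite !(mul0r, mulr0, subr0, addr0, add0r, oppr0)
    -(sum_i1i2 (fun p => delta R m p * tau i (E1 n) p)) sum_delta.
have cA i : c i1 * A x i i2 = c i2 * A x i i1.
  move: (T1 i (E1 i1) (E1 i2)); rewrite !sum_i1i2 !(HE1 _ _).1 !wE1 !t1 /delta/=.
  by rewrite !(mul0r, mulr0, subr0, addr0, add0r, mul1r, mulr1, oppr0, sub0r) mulrN
     => /eqP; rewrite subr_eq0 => /eqP.
have c0 : \col_(k < 2) (if k == i1 then - c i2 else c i1) = 0.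
  rewrite -[LHS](mulKmx (uA _ Vx)) (_ : A x *m _ = 0) ?mulmx0//.
  apply/colP => i; rewrite !mxE sum_i1i2 !mxE /= mulrN [A x i i2 * _]mulrC cA mulrC.
  by rewrite addNr.
have {}c0 k : c k = 0.
  have := c0 => /colP h; have := h i1; have := h i2; rewrite !mxE /= => z1 /eqP.
  rewrite oppr_eq0 => /eqP z2; case: (eqVneq k i1) => [->//|k1].
  rewrite -z2; congr (c _); apply: val_inj; move: k k1 => [[|[|//]] p] //.
by have := c0 j; rewrite /c => /eqP; rewrite subr_eq0 => /eqP.
Qed.

End CovectorChange.

(** * Existence of the structure on a changed frame *)

Section StructureChange.
Context {R : realType}.

Lemma recompose_frame (A : 'M[R]_2) (Y : 'I_2 -> R) m : A \in unitmx ->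
  \sum_j A j m * (\sum_n invmx A n j * Y n) = Y m.
Proof.
move=> uA; rewrite -[RHS](sum_delta Y).
under eq_bigr => j _ do rewrite mulr_sumr.
rewrite exchange_big/=; apply: eq_bigr => n _.
rewrite /delta eq_sym -/(delta R n m) -(invmx_suml n m uA) mulr_suml.
by apply: eq_bigr => j _; rewrite mulrA [A j m * _]mulrC.
Qed.

(* The solution [conn'] of [dA i m = sum_k A i k conn m k - sum_j A j m conn' j i]. *)
Definition change_conn (A : 'rV[R]_4 -> 'M[R]_2) (S : web_structure R) (j i : 'I_2) : form1 R 4 :=
  fun x => \sum_m invmx (A x) m j *:
    ((fun y => (fun z => \sum_k A z i k *: conn S m k z) y - exact_form (fun z => A z i m) y) x).

(** The covector, its derivatives and the curvature follow the tensor laws, each lower index taking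
    an inverse of [A]; only the connection has an inhomogeneous term. *)
Definition change_structure (A : 'rV[R]_4 -> 'M[R]_2) (S : web_structure R) : web_structure R :=
  WebStructure (change_conn A S)
    (fun j x => \sum_m invmx (A x) m j * cov S m x)
    (fun i j x => \sum_k \sum_l invmx (A x) k i * invmx (A x) l j * pcov S k l x)
    (fun i j x => \sum_k \sum_l invmx (A x) k i * invmx (A x) l j * qcov S k l x)
    (fun i j k l x => \sum_q \sum_r \sum_s \sum_u
       A x i q * invmx (A x) r j * invmx (A x) s k * invmx (A x) u l * curv S q r s u x).

Context (V : set 'rV[R]_4) (omega omega' : web_forms R) (A : 'rV[R]_4 -> 'M[R]_2).
Context (S : web_structure R).
Context (oV : open V) (somega : forall u i, smooth_on V (omega u i)).
Context (sA : smooth_on V A) (uA : forall x, V x -> A x \in unitmx).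
Context (omegaE : forall x, V x -> forall u i, omega' u i x = \sum_j A x i j *: omega u j x).
Context (st : structure_equations V omega S).

Let S' := change_structure A S.

Lemma ev_omega_inv u r x v : V x ->
  ev (omega u r) x v = \sum_k invmx (A x) r k * ev (omega' u k) x v.
Proof.
move=> Vx; rewrite -[LHS](sum_delta (fun n => ev (omega u n) x v)).
under [RHS]eq_bigr => k _ do rewrite (ev_omega' omegaE)// mulr_sumr.
rewrite exchange_big/=; apply: eq_bigr => n _.
rewrite -(invmx_suml r n (uA Vx)) mulr_suml.
by apply: eq_bigr => j _; rewrite mulrA.
Qed.

Lemma change_connE j i x v : V x -> ev (change_conn A S j i) x v =
  \sum_m invmx (A x) m j * (\sum_k A x i k * ev (conn S m k) x v - 'D_v (fun z => A z i m : R) x).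
Proof.
move=> Vx; rewrite ev_sum; apply: eq_bigr => m _; congr (_ * _).
by rewrite evB ev_sum ev_exact//; exact: (differentiable_entry oV sA).
Qed.

Lemma change_conn_gauge i m x v : V x -> 'D_v (fun z => A z i m : R) x =
  \sum_k A x i k * ev (conn S m k) x v - \sum_j A x j m * ev (conn S' j i) x v.
Proof.
move=> Vx; rewrite (eq_bigr _ (fun j _ => congr1 (GRing.mul (A x j m)) (change_connE j i v Vx))).
rewrite (recompose_frame (fun n => \sum_k A x i k * ev (conn S n k) x v -
  'D_v (fun z => A z i n : R) x) m (uA Vx)).
by rewrite opprB addrC subrK.
Qed.

Lemma smooth_change_conn j i : smooth_on V (conn S' j i).
Proof.
have [[sc _] _ _ _ _] := st.
apply: smooth_lincomb => // m; first exact: (smooth_invmx oV sA uA).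
move=> k; apply: Ck_form => // p.
have h1 : Ck k V (fun x => \sum_l A x i l *: conn S m l x).
  by apply: smooth_lincomb => // l; exact: smooth_entry.
have h2 : Ck k V (exact_form (fun z => A z i m)).
  by apply: smooth_exact => //; exact: smooth_entry.
apply: (@Ck_eq _ _ _ _ _ (fun y => (\sum_l A y i l *: conn S m l y) p 0 -
  exact_form (fun z => A z i m) y p 0)) => //.
  by move=> y _; rewrite !mxE.
apply: Ck_add => //; first exact: (Ck_coord p oV h1).
by apply: Ck_opp => //; exact: (Ck_coord p oV h2).
Qed.

Lemma smooth_change_cov i : smooth_on V (cov S' i : 'rV[R]_4 -> R).
Proof.
have [[_ sc] _ _ _ _] := st.
move=> k; apply: Ck_sum => // m; apply: Ck_mul => //; first exact: (smooth_invmx oV sA uA).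
exact: sc.
Qed.

Lemma change_covE m x : V x -> cov S m x = \sum_j cov S' j x * A x j m.
Proof.
move=> Vx; rewrite -[LHS](recompose_frame (fun n => cov S n x) m (uA Vx)).
by apply: eq_bigr => j _; rewrite mulrC.
Qed.

(** Both defects in [torsion_identity] vanish: [tau] by [change_conn_gauge], that of the covector by
    [change_covE]. *)
Lemma change_torsion u eps x v v' i : V x ->
  (forall k, dform (omega u k) x v v' = \sum_j wedge (omega u j) (conn S j k) x v v' +
     eps * \sum_j cov S j x * wedge (omega u j) (omega u k) x v v') ->
  dform (omega' u i) x v v' = \sum_j wedge (omega' u j) (conn S' j i) x v v' +
     eps * \sum_j cov S' j x * wedge (omega' u j) (omega' u i) x v v'.
Proof.
move=> Vx h; apply/esym/eqP; rewrite -subr_eq0.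
rewrite (torsion_identity oV somega sA omegaE (S := S) (conn S') (fun m => cov S' m x) i Vx h).
have tau0 y m : \sum_j A x j m * ev (conn S' j i) x y + 'D_y (fun z => A z i m : R) x -
    \sum_k A x i k * ev (conn S m k) x y = 0.
  by rewrite change_conn_gauge// addrC [\sum_j _ + _]addrC subrK addrC subrr.
rewrite big1 => [|m _]; last by rewrite !tau0 !mulr0 subrr.
rewrite add0r big1 ?mulr0// => j _.
by rewrite (change_covE j Vx) subrr mul0r.
Qed.

Lemma change_curvature i j x v v' : V x ->
  dform (conn S' j i) x v v' - \sum_k wedge (conn S' j k) (conn S' k i) x v v' =
  \sum_k \sum_l curv S' i j k l x * wedge (omega' u1 k) (omega' u2 l) x v v'.
Proof.
move=> Vx; have [[sc _] _ e2 _ _] := st.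
have H m : \sum_j A x j m * (dform (conn S' j i) x v v' -
     \sum_k wedge (conn S' j k) (conn S' k i) x v v') =
   \sum_k A x i k * (dform (conn S m k) x v v' -
     \sum_l wedge (conn S m l) (conn S l k) x v v').
  apply: (@frame_change_curvature _ (A x) (fun i k => 'D_v (fun y => A y i k : R) x)
    (fun i k => 'D_v' (fun y => A y i k : R) x)
    (fun m k => ev (conn S m k) x v) (fun m k => ev (conn S m k) x v')
    (fun m k => ev (conn S' m k) x v) (fun m k => ev (conn S' m k) x v')
    (fun m k => dform (conn S m k) x v v') (fun m k => dform (conn S' m k) x v v')).
  - by move=> i' m'; exact: change_conn_gauge.
  - by move=> i' m'; exact: change_conn_gauge.
  have dAe p q : differentiable (fun y => A y p q : R) x by exact: (differentiable_entry oV sA).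
  have dc p q : differentiable (conn S p q) x by exact: Ck_diff (sc p q 1) Vx.
  have dc' p q : differentiable (conn S' p q) x by exact: Ck_diff (smooth_change_conn p q 1) Vx.
  rewrite -(dform_lincomb v v' (fun q => dAe q m) (fun q => dc' q i)).
  rewrite -(dform_lincomb v v' (fun q => dAe i q) (fun q => dc m q)).
  (* By the gauge relation the two combinations of connection forms differ by the exact form [dA],
     which is closed, so their exterior derivatives agree. *)
  have dex : dform (exact_form (fun y => A y i m)) x v v' = 0.
    by apply: (dform_exact v v' oV Vx); exact: smooth_entry.
  rewrite -[RHS]subr0 -dex -dformB; first last.
  - apply: (Ck_diff (k := 0) (U := V)) => //; apply: (smooth_exact oV _ 1).
    exact: smooth_entry.
  - have h1 : Ck 1 V (fun x => \sum_l A x i l *: conn S m l x).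
      by apply: smooth_lincomb => // l; exact: smooth_entry.
    exact: Ck_diff h1 Vx.
  apply: (dform_eq v v' oV Vx) => y Vy.
  apply: (@form_ext _ _ (fun y => \sum_q A y q m *: conn S' q i y)
    (fun y => \sum_q A y i q *: conn S m q y - exact_form (fun y => A y i m) y)) => u.
  rewrite evB !ev_sum ev_exact; last exact: (differentiable_entry oV sA).
  by rewrite change_conn_gauge// opprB addrC subrK.
rewrite (solve_frame (uA Vx) H j).
have wE := ev_omega_inv _ _ _ Vx.
under eq_bigr => m _.
  under eq_bigr => k _ do rewrite e2//.
  over.
(* Expressing the old forms in the new coframe supplies the inverse matrices on the last two indices
   of the new curvature. *)
rewrite /= /wedge !sum_i1i2 !wE !sum_i1i2.
ring.
Qed.

Lemma change_covector i x v : V x ->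
  'D_v (cov S' i : 'rV[R]_4 -> R) x - \sum_j cov S' j x * ev (conn S' i j) x v =
  \sum_j (pcov S' i j x * ev (omega' u1 j) x v + qcov S' i j x * ev (omega' u2 j) x v).
Proof.
move=> Vx; have [[_ sc] _ _ e3 _] := st.
have dAe p q : differentiable (fun y => A y p q : R) x by exact: (differentiable_entry oV sA).
have dc' p : differentiable (cov S' p : _ -> R) x by exact: Ck_diff (smooth_change_cov p 1) Vx.
have Da m : 'D_v (cov S m : _ -> R) x = \sum_j ('D_v (cov S' j : _ -> R) x * A x j m +
    cov S' j x * 'D_v (fun y => A y j m : R) x).
  have hj j : is_derive x v ((cov S' j : _ -> R) * (fun y => A y j m : R))
     ('D_v (cov S' j : _ -> R) x * A x j m + cov S' j x * 'D_v (fun y => A y j m : R) x).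
    have := is_deriveM (derivableP (diff_derivable (v := v) (dc' j)))
      (derivableP (diff_derivable (v := v) (dAe j m))).
    by move/is_derive_eq; apply; rewrite addrC [_ *: 'D_v (cov _ _) x]mulrC.
  have [_ <-] := is_derive_sum hj.
  have [r r0 rV] := open_ball_sub oV Vx.
  apply: near_eq_derive; apply/nbhs_ballP; exists r => // y /rV Vy.
  by rewrite (change_covE m Vy) fct_sumE.
have H m : \sum_j A x j m * ('D_v (cov S' j : _ -> R) x - \sum_l cov S' l x * ev (conn S' j l) x v) =
   'D_v (cov S m : _ -> R) x - \sum_k cov S k x * ev (conn S m k) x v.
  apply: (@frame_change_covector _ (A x) (fun i k => 'D_v (fun y => A y i k : R) x)
    (fun m k => ev (conn S m k) x v) (fun m k => ev (conn S' m k) x v)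
    (fun m => 'D_v (cov S m : _ -> R) x) (fun m => cov S m x)
    (fun m => 'D_v (cov S' m : _ -> R) x) (fun m => cov S' m x)) => //.
    by move=> i' m'; exact: change_conn_gauge.
  by move=> m'; exact: change_covE.
rewrite (solve_frame (uA Vx) H i).
have wE := ev_omega_inv _ _ _ Vx.
under eq_bigr => m _ do rewrite e3//.
rewrite /= !sum_i1i2 !wE !sum_i1i2.
ring.
Qed.

Lemma change_structureP : structure_equations V omega' S'.
Proof.
have [_ e1 _ _ e4] := st; split.
- by split; [exact: smooth_change_conn|exact: smooth_change_cov].
- move=> x Vx i v v'; split.
    rewrite (@change_torsion u1 1 x v v' i Vx) ?mul1r// => k.
    by rewrite mul1r; exact: (e1 x Vx k v v').1.
  rewrite (@change_torsion u2 (-1) x v v' i Vx) ?mulN1r// => k.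
  by rewrite mulN1r; exact: (e1 x Vx k v v').2.
- by move=> x Vx i j v v'; exact: change_curvature.
- by move=> x Vx i v; exact: change_covector.
- move=> x Vx i j k l; split.
    apply: (frame_change_alt1 (A := A x) (b := fun i j k l => curv S i j k l x)
      (p := fun i j => pcov S i j x)) => [i' k'|i' j' k' l']; first exact: invmx_sumr (uA Vx).
    exact: (e4 x Vx i' j' k' l').1.
  apply: (frame_change_alt2 (A := A x) (b := fun i j k l => curv S i j k l x)
    (p := fun i j => qcov S i j x)) => [i' k'|i' j' k' l']; first exact: invmx_sumr (uA Vx).
  exact: (e4 x Vx i' j' k' l').2.
Qed.

End StructureChange.

(** * Structure equations restricted to an integral surface *)

Section CutWeb.
Context {R : realType}.

Lemma pullback_web_connection (V : set 'rV[R]_4) (omega : web_forms R) (S : web_structure R)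
    (D : set 'rV[R]_2) (phi : 'rV[R]_2 -> 'rV[R]_4) :
  open V -> (forall u i, smooth_on V (omega u i)) -> structure_equations V omega S ->
  (forall x, V x -> cov S i2 x = 0) ->
  (forall x v, V x -> (forall i, ev (omega u1 i) x v = 0) ->
    (forall i, ev (omega u2 i) x v = 0) -> v = 0) ->
  open D -> smooth_on D phi -> (forall t, D t -> V (phi t)) ->
  (forall t, D t -> forall v, 'D_v phi t = 0 -> v = 0) ->
  (forall t v, D t -> pull1 phi (omega u1 i1) t v = 0 /\ pull1 phi (omega u2 i1) t v = 0) ->
  web_connection D (pullback phi (omega u1 i2)) (pullback phi (omega u2 i2))
    (pullback phi (conn S i2 i2)) (fun t => curv S i2 i2 i2 i2 (phi t)).
Proof.
move=> oV sw st a2 cof oD sphi DV imm int.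
have [[sc _] e1 e2 _ _] := st.
have dphi t : D t -> differentiable phi t by exact: Ck_diff (sphi 1).
have ind t v : D t -> ev (pullback phi (omega u1 i2)) t v = 0 ->
    ev (pullback phi (omega u2 i2)) t v = 0 -> v = 0.
  move=> Dt; rewrite !ev_pullback; [|exact: dphi|exact: dphi] => h1 h2.
  apply: (imm t Dt); apply: (cof _ _ (DV _ Dt)) => i; have [k1 k2] := int t v Dt.
    by case: (eqVneq i i1) => [->//|/negbTE]; case: i => -[|[|//]] p // _;
      rewrite -h1; congr (ev (omega _ _) _ _); exact: val_inj.
  by case: (eqVneq i i1) => [->//|/negbTE]; case: i => -[|[|//]] p // _;
    rewrite -h2; congr (ev (omega _ _) _ _); exact: val_inj.
have dw u i t : D t -> differentiable (omega u i) (phi t).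
  by move=> Dt; exact: Ck_diff (sw u i 1) (DV _ Dt).
have dpull w t v v' : D t -> differentiable w (phi t) ->
    dform (pullback phi w) t v v' = dform w (phi t) ('D_v phi t) ('D_v' phi t).
  by move=> Dt dwt; exact: (dform_pullback v v' oD Dt (sphi 2) dwt).
have z1 t v : D t -> ev (omega u1 i1) (phi t) ('D_v phi t) = 0 by move=> Dt; exact: (int t v Dt).1.
have z2 t v : D t -> ev (omega u2 i1) (phi t) ('D_v phi t) = 0 by move=> Dt; exact: (int t v Dt).2.
have zero t v : D t -> ev (conn S i2 i1) (phi t) ('D_v phi t) = 0.
  move=> Dt.
  (* In the equation for omega_(u)^1, the term in omega_1^1 and the torsion terms contain
     omega_(u)^1 itself; on the surface only omega_(u)^2 /\ omega_2^1 = 0 remains, whatever the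
     torsion sign [eps]. *)
  have key u (eps : R) : (forall v v', dform (omega u i1) (phi t) v v' =
       \sum_j wedge (omega u j) (conn S j i1) (phi t) v v' +
       eps * \sum_j cov S j (phi t) * wedge (omega u j) (omega u i1) (phi t) v v') ->
     (forall t v, D t -> ev (omega u i1) (phi t) ('D_v phi t) = 0) ->
     forall v v', wedge (pullback phi (omega u i2)) (pullback phi (conn S i2 i1)) t v v' = 0.
    move=> st1 zu v1 v2.
    have := dpull (omega u i1) t v1 v2 Dt (dw u i1 t Dt).
    rewrite (dform0 v1 v2 oD Dt) => [|y w Dy]; last by rewrite ev_pullback ?zu//; exact: dphi.
    rewrite st1 wedge_pullback; last exact: dphi.
    move: (zu t v1 Dt) (zu t v2 Dt).
    move: ('D_v1 phi t) ('D_v2 phi t) (phi t) => x1 x2 y h1 h2.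
    rewrite !sum_i1i2 /wedge h1 h2 => /esym E; rewrite -[RHS]E; ring.
  have k1 := key u1 1 _ z1; have k2 := key u2 (-1) _ z2.
  have {}k1 := k1 (fun v v' => etrans (e1 _ (DV _ Dt) i1 v v').1 (congr1 _ (esym (mul1r _)))).
  have {}k2 := k2 (fun v v' => etrans (e1 _ (DV _ Dt) i1 v v').2 (congr1 _ (esym (mulN1r _)))).
  have W0 := wedge_neq0 (fun v => ind t v Dt).
  have := k1 (delta_mx 0 i1) (delta_mx 0 i2); have := k2 (delta_mx 0 i1) (delta_mx 0 i2).
  rewrite /wedge => /eqP; rewrite subr_eq0 => /eqP h2 /eqP; rewrite subr_eq0 => /eqP h1.
  rewrite -ev_pullback; last exact: dphi.
  rewrite [v]vec2E ev_vec2; move: W0; rewrite wedge_e1e2 => W0.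
  have [|| -> ->] := cramer0 W0 (u := ev (pullback phi (conn S i2 i1)) t (delta_mx 0 i1))
    (w := ev (pullback phi (conn S i2 i1)) t (delta_mx 0 i2)).
  - by rewrite mulrC -h1 mulrC.
  - by rewrite mulrC -h2 mulrC.
  by rewrite !mulr0 addr0.
split.
- by split=> //; apply: (smooth_pullback oD oV DV) => //; exact: sc.
- exact: ind.
- move=> t v v' Dt; rewrite dpull//; last exact: dw.
  rewrite (e1 _ (DV _ Dt) i2 _ _).1 wedge_pullback; last exact: dphi.
  move: (a2 _ (DV _ Dt)) (z1 t v Dt) (z1 t v' Dt).
  move: ('D_v phi t) ('D_v' phi t) (phi t) => x1 x2 y a0 h1 h2.
  rewrite !sum_i1i2 a0 /wedge h1 h2; ring.
- move=> t v v' Dt; rewrite dpull//; last exact: dw.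
  rewrite (e1 _ (DV _ Dt) i2 _ _).2 wedge_pullback; last exact: dphi.
  move: (a2 _ (DV _ Dt)) (z2 t v Dt) (z2 t v' Dt).
  move: ('D_v phi t) ('D_v' phi t) (phi t) => x1 x2 y a0 h1 h2.
  rewrite !sum_i1i2 a0 /wedge h1 h2; ring.
(* The product omega_2^1 /\ omega_1^2 disappears by [zero], and every curvature term with [k] or [l]
   equal to [i1] contains a vanishing form; b^2_222 alone remains. *)
- move=> t v v' Dt; rewrite dpull//; last exact: Ck_diff (sc i2 i2 1) (DV _ Dt).
  rewrite wedge_pullback; last exact: dphi.
  move: (e2 _ (DV _ Dt) i2 i2 ('D_v phi t) ('D_v' phi t)) => /eqP; rewrite subr_eq => /eqP ->.
  move: (z1 t v Dt) (z1 t v' Dt) (z2 t v Dt) (z2 t v' Dt) (zero t v Dt) (zero t v' Dt).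
  move: ('D_v phi t) ('D_v' phi t) (phi t) => x1 x2 y h1 h2 h3 h4 h5 h6.
  rewrite !sum_i1i2 /wedge h1 h2 h3 h4 h5 h6; ring.
Qed.

End CutWeb.

(** * The cut web in a changed frame and the specialized frame *)

Section SpecialFrame.
Context {R : realType}.

Lemma ord2_cases (i : 'I_2) : i = i1 \/ i = i2.
Proof. by case: i => -[|[|//]] p; [left|right]; exact: val_inj. Qed.

Lemma ord3_cases (u : 'I_3) : [\/ u = u1, u = u2 | u = u3].
Proof.
by case: u => -[|[|[|//]]] p; [apply: Or31|apply: Or32|apply: Or33]; exact: val_inj.
Qed.

(** An invertible change of frame keeps the common kernel of the two forms of a foliation. Where the
    first form of each pair vanishes on the surface, one linear condition per foliation is left, and
    the normalization makes the third form minus the sum of the other two. *)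
Lemma cut_web_frame (V : set 'rV[R]_4) (omega omega' : web_forms R) (A : 'rV[R]_4 -> 'M[R]_2)
    (phi : 'rV[R]_2 -> 'rV[R]_4) t u v :
  (forall x, V x -> A x \in unitmx) ->
  (forall x, V x -> forall u i, omega' u i x = \sum_j A x i j *: omega u j x) ->
  V (phi t) -> differentiable phi t ->
  (forall i, omega u1 i (phi t) + omega u2 i (phi t) + omega u3 i (phi t) = 0) ->
  (pull1 phi (omega' u1 i1) t v = 0 /\ pull1 phi (omega' u2 i1) t v = 0) ->
  cut_web omega phi u t v <->
  web_of_forms (pullback phi (omega' u1 i2)) (pullback phi (omega' u2 i2)) u t v.
Proof.
move=> uA E Vt dphi sum0 [z1 z2]; set x := phi t in Vt sum0.
have e3 i : ev (omega' u3 i) x ('D_v phi t) =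
    - (ev (omega' u1 i) x ('D_v phi t) + ev (omega' u2 i) x ('D_v phi t)).
  rewrite !(ev_omega' E)// -big_split/= -sumrN; apply: eq_bigr => j _.
  rewrite -mulrDr -mulrN; congr (_ * _); apply/eqP; rewrite -subr_eq0 opprK addrC; apply/eqP.
  have -> : 0 = ev (fun=> omega u1 j x + omega u2 j x + omega u3 j x) x ('D_v phi t).
    by rewrite sum0 /ev mulmx0 mxE.
  by rewrite /ev !mulmxDr !mxE.
have H w : ev (omega' w i1) x ('D_v phi t) = 0 ->
    cut_web omega phi w t v <-> ev (omega' w i2) x ('D_v phi t) = 0.
  move=> w0; split=> [cw|w2 i].
    by rewrite (ev_omega' E)// big1// => j _; rewrite [ev _ _ _]cw mulr0.
  rewrite [LHS](ev_omega_inv uA E)// sum_i1i2 w0 w2; by rewrite !mulr0 addr0.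
rewrite /web_of_forms !ev_pullback//.
case: (ord3_cases u) => -> /=; [exact: H|exact: H|].
apply: iff_trans (H u3 _) _; first by rewrite e3 [ev _ _ _]z1 [ev _ _ _]z2 addr0 oppr0.
rewrite e3; split=> [/eqP|->]; last by rewrite oppr0.
by rewrite oppr_eq0 => /eqP.
Qed.

(* First row [a]: the first forms of the new frame are those defining [Delta]. *)
Definition special_frame (S : web_structure R) (x : 'rV[R]_4) : 'M[R]_2 :=
  \matrix_(i, j) if i == i1 then cov S j x
                 else if j == i1 then - cov S i2 x else cov S i1 x.

(** The rows are orthogonal with the same squared length [n], so the transpose divided by [n] is an
    inverse. *)
Lemma special_frame_unit (S : web_structure R) x :
  (exists i, cov S i x <> 0) -> special_frame S x \in unitmx.
Proof.
move=> [i ai]; pose n := cov S i1 x ^+ 2 + cov S i2 x ^+ 2.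
have n0 : n != 0.
  rewrite /n paddr_eq0 ?sqr_ge0// !sqrf_eq0; apply/negP => /andP[/eqP h1 /eqP h2].
  by apply: ai; case: (ord2_cases i) => ->.
suff : special_frame S x *m (n^-1 *: (special_frame S x)^T) = 1%:M by move=> /mulmx1_unit[].
rewrite -scalemxAr; apply: (canLR (scalerK n0)); apply/matrixP => j k.
rewrite !mxE sum_i1i2 !mxE /n.
by case: (ord2_cases j) => ->; case: (ord2_cases k) => -> /=; ring.
Qed.

Lemma smooth_special_frame (S : web_structure R) (U : set 'rV[R]_4) : open U ->
  (forall i, smooth_on U (cov S i : _ -> R)) -> smooth_on U (special_frame S).
Proof.
move=> oU sc k; apply/(Ck_mxP _ _ oU) => i j.
case: (ord2_cases i) => ->; last case: (ord2_cases j) => ->.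
- by apply: (@Ck_eq _ _ _ _ _ (cov S j)) => // [x _|]; [rewrite mxE|exact: sc].
- apply: (@Ck_eq _ _ _ _ _ (fun x => - cov S i2 x)) => // [x _|]; first by rewrite mxE.
  by apply: Ck_opp => //; exact: sc.
- by apply: (@Ck_eq _ _ _ _ _ (cov S i1)) => // [x _|]; [rewrite mxE|exact: sc].
Qed.

End SpecialFrame.

(** * Hexagonality of the cut webs and the component b^2_222 *)

Theorem theorem6 (R : realType) (U : set 'rV[R]_4) (omega : web_forms R)
    (S : web_structure R)
    (openU : open U)
    (web : is_web322 U omega)
    (struct : structure_equations U omega S)
    (a_neq0 : forall x, U x -> exists i, cov S i x <> 0)
    (Delta_int : integrable2 U (a_distribution omega S)) :
  (forall D phi, integral_surface U (a_distribution omega S) D phi ->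
     hexagonal D (cut_web omega phi))
  <->
  (forall (V : set 'rV[R]_4) (omega' : web_forms R) (S' : web_structure R),
     open V -> V `<=` U ->
     admissible_change V omega omega' ->
     structure_equations V omega' S' ->
     (forall x, V x -> cov S' i2 x = 0) ->
     forall x, V x -> curv S' i2 i2 i2 i2 x = 0).
Proof.
have [sw sum0 _ _] := web; have [[_ sc] _ _ _ _] := struct.
split=> [hex V omega' S' oV VU [A [sA uA E]] struct' a2 x Vx|flat D phi surf].
- have covE := cov_change oV VU web struct sA uA E struct'.
  have Ux := VU _ Vx.
  have somega u i : smooth_on V (omega u i) by move=> k; exact: Ck_sub VU (sw u i k).
  have [D [phi [[oD sphi DU imm int] [t Dt phit]]]] := Delta_int x Ux.
  (* The surface through [x] lies in [U], while the given frame lives on [V]; the part of the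
     surface over [V] is again an integral surface, so hexagonality applies to it. *)
  pose D' := D `&` phi @^-1` V.
  have oD' : open D'.
    rewrite openE => s [Ds Vs].
    have cphi : {for s, continuous phi} by exact/differentiable_continuous/(Ck_diff (sphi 1) Ds).
    have n1 : nbhs s D by apply: open_nbhs_nbhs.
    have n2 : nbhs s (phi @^-1` V) by apply: cphi; apply: open_nbhs_nbhs.
    exact: filterI n1 n2.
  have sphi' : smooth_on D' phi by move=> k; apply: Ck_sub (sphi k) => s [].
  have surf' : integral_surface U (a_distribution omega S) D' phi.
    by split=> // [s [Ds _]|s [Ds _]|s [Ds _]]; [exact: DU|exact: imm|exact: int].
  have int' s v : D' s -> pull1 phi (omega' u1 i1) s v = 0 /\ pull1 phi (omega' u2 i1) s v = 0.
    move=> [Ds Vs].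
    have a1 : cov S' i1 (phi s) != 0.
      apply/eqP => a10; have [i] := a_neq0 (phi s) (VU _ Vs); apply.
      by rewrite (covE _ Vs) sum_i1i2 a10 (a2 _ Vs) !mul0r addr0.
    (* With a'_2 = 0, the relation a = a'A reads a_j = a'_1 A_1j: the forms defining Delta are a'_1
       times the first forms of the new frame, and a'_1 is nonzero because a is. *)
    have key al : cov S' i1 (phi s) * pull1 phi (omega' (if al then u2 else u1) i1) s v =
        pull1 phi (a_distribution omega S al) s v.
      rewrite /pull1 (ev_omega' E)// ev_sum mulr_sumr; apply: eq_bigr => j _.
      by rewrite (covE _ Vs) sum_i1i2 (a2 _ Vs) mul0r addr0 mulrA.
    have z al : pull1 phi (omega' (if al then u2 else u1) i1) s v = 0.
      by apply: (mulfI a1); rewrite key mulr0; exact: int.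
    by split; [exact: (z false)|exact: (z true)].
  rewrite -phit.
  have conn' : web_connection D' (pullback phi (omega' u1 i2)) (pullback phi (omega' u2 i2))
      (pullback phi (conn S' i2 i2)) (fun t => curv S' i2 i2 i2 i2 (phi t)).
    apply: (pullback_web_connection oV) => //.
    + exact: (smooth_omega' oV somega sA E).
    + move=> y v Vy h1 h2; apply: (web_coframe web (VU _ Vy)) => i.
        by rewrite (ev_omega_inv uA E)// big1// => k _; rewrite h1 mulr0.
      by rewrite (ev_omega_inv uA E)// big1// => k _; rewrite h2 mulr0.
    + by move=> s [].
    + by move=> s [Ds _]; exact: imm.
  apply: (hexagonal_curvature0 conn' _ (hex D' phi surf')); last by split=> //=; rewrite phit.
  move=> s u v D's; have [Ds Vs] := D's.
  apply: (cut_web_frame _ uA E) => //; [exact: Ck_diff (sphi 1) Ds| |exact: int'].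
  by move=> i; apply: sum0; exact: VU.
have [oD sphi DU imm int] := surf.
(* One specialized frame over the whole of [U] serves every integral surface. *)
pose A := special_frame S; pose S' := change_structure A S.
pose omega' : web_forms R := fun u i x => \sum_j A x i j *: omega u j x.
have uA x : U x -> A x \in unitmx by move=> Ux; apply: special_frame_unit; exact: a_neq0.
have sA : smooth_on U A by exact: smooth_special_frame.
have E x : U x -> forall u i, omega' u i x = \sum_j A x i j *: omega u j x by [].
have struct' : structure_equations U omega' S' := change_structureP openU sw sA uA E struct.
(* The first row of [A] is the covector itself, so multiplying it by the inverse of [A] gives the
   row [(1, 0)]. *)
have a2 x : U x -> cov S' i2 x = 0.
  move=> Ux; rewrite -[RHS](_ : delta R i1 i2 = 0)// -(invmx_sumr i1 i2 (uA _ Ux)).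
  by apply: eq_bigr => m _; rewrite [A x i1 m]mxE /= mulrC.
have int' s v : D s -> pull1 phi (omega' u1 i1) s v = 0 /\ pull1 phi (omega' u2 i1) s v = 0.
  move=> Ds.
  have key al : pull1 phi (omega' (if al then u2 else u1) i1) s v =
      pull1 phi (a_distribution omega S al) s v.
    by rewrite /pull1 !ev_sum; apply: eq_bigr => j _; rewrite [A _ _ _]mxE.
  by split; [rewrite (key false)|rewrite (key true)]; exact: int.
have conn' : web_connection D (pullback phi (omega' u1 i2)) (pullback phi (omega' u2 i2))
    (pullback phi (conn S' i2 i2)) (fun t => curv S' i2 i2 i2 i2 (phi t)).
  apply: (pullback_web_connection openU) => //.
  + exact: (smooth_omega' openU sw sA E).
  + move=> y v Uy h1 h2; apply: (web_coframe web Uy) => i.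
      by rewrite (ev_omega_inv uA E)// big1// => k _; rewrite h1 mulr0.
    by rewrite (ev_omega_inv uA E)// big1// => k _; rewrite h2 mulr0.
apply: (curvature0_hexagonal conn') => [s u v Ds|s Ds].
  apply: (cut_web_frame _ uA E) => //; [exact: DU|exact: Ck_diff (sphi 1) Ds| |exact: int'].
  by move=> i; apply: sum0; exact: DU.
apply: (flat U omega' S') => //; [by exists A|exact: DU].
Qed.
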